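(* $$\limsup_{n\to\infty}\frac{\tilde{P}(n)}{n\log\log n}=\frac{6}{\pi^2}e^{\gamma},$$ where $\gamma$ is Euler's constant.
   Context: For $n=\prod_{i=1}^r p_i^{a_i}>1$ in canonical form, $\kappa(n)=\prod_i p_i$ (and $\kappa(1)=1$). For $n=\prod_{i=1}^r p_i^{a_i}$, $m=\prod_{i=1}^r p_i^{b_i}$ with the same prime factors ($a_i,b_i\ge1$), $(n,m)_{(e)}=\prod_{i=1}^r p_i^{\gcd(a_i,b_i)}$, and $(1,1)_{(e)}=1$. Define $\tilde{P}(n)=\sum_{1\le j\le n,\ \kappa(j)=\kappa(n)}(j,n)_{(e)}$. Equivalently, $\tilde P$ is multiplicative with $\tilde{P}(p^a)=\sum_{c=1}^{a}p^{\gcd(c,a)}=\sum_{d\mid a}p^d\phi(a/d)$ for prime powers ($a\ge1$), $\phi$ being Euler's function, and $\tilde P(1)=1$.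
   Formalization: P̃ is taken as the multiplicative function with P̃(p^a)=Σ_{c≤a} p^{gcd(c,a)}; the displayed sum over all j≤n with κ(j)=κ(n) is not equal to it (n=18: 30 versus 24), and the limsup formula is false for that sum. *)

(* Defs.v *)
From HB Require Import structures.
From mathcomp Require Import all_boot all_order all_algebra.
From mathcomp Require Import all_classical all_reals all_analysis.
Set Implicit Arguments.
Unset Strict Implicit.
Unset Printing Implicit Defensive.
Import Order.TTheory GRing.Theory Num.Theory.

(* The exponential Pillai function.  It is the multiplicative function with
   Ptilde (p ^ a) = \sum_(1 <= c <= a) p ^ gcd(c, a), that is, the sum of the
   exponential gcds (j, n)_(e) over the j = \prod p ^ c_p with p running over
   the primes dividing n and 1 <= c_p <= v_p(n).  Pitfall: summing instead over
   every j <= n having the same prime divisors as n allows c_p > v_p(n) and does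
   not give a multiplicative function: for n = 18 = 2 * 3 ^ 2 it adds j = 12 and
   yields 30 in place of Ptilde 2 * Ptilde 9 = 24. *)
Definition Ptilde (n : nat) : nat :=
  \prod_(p <- primes n) \sum_(1 <= c < (logn p n).+1) p ^ gcdn c (logn p n).

Lemma Ptilde1 : Ptilde 1 = 1.
Proof. by rewrite /Ptilde big_nil. Qed.

Lemma Ptilde_prime_pow p a : prime p -> 0 < a ->
  Ptilde (p ^ a) = \sum_(1 <= c < a.+1) p ^ gcdn c a.
Proof.
move=> pp a0; rewrite /Ptilde primesX // primes_prime // big_seq1.
by rewrite pfactorK.
Qed.

Lemma PtildeM m n : 0 < m -> 0 < n -> coprime m n ->
  Ptilde (m * n) = Ptilde m * Ptilde n.
Proof.
move=> m0 n0 cmn.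
have pe : perm_eq (primes (m * n)) (primes m ++ primes n).
  apply: uniq_perm; first exact: primes_uniq.
    rewrite cat_uniq !primes_uniq andbT /=.
    by have := cmn; rewrite coprime_has_primes // has_sym.
  by move=> p; rewrite mem_cat primesM.
rewrite /Ptilde (perm_big _ pe) big_cat /=; congr (_ * _).
  apply: eq_big_seq => p; rewrite mem_primes => /and3P[pp _ pm].
  rewrite lognM // [logn p n](_ : _ = 0) ?addn0 //.
  by apply: logn_coprime; exact: coprime_dvdl pm cmn.
apply: eq_big_seq => p; rewrite mem_primes => /and3P[pp _ pn].
rewrite lognM // [logn p m](_ : _ = 0) ?add0n //.
by apply: logn_coprime; apply: coprime_dvdl pn _; rewrite coprime_sym.
Qed.

Local Open Scope ring_scope.

Definition euler_gamma {R : realType} : R :=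
  limn (fun n : nat => series harmonic n - ln n%:R).

(* Main.v *)
(* With v = v_p(n), the local factor of Ptilde n / n at p is at most 1 + 1/p
   (with equality for v = 2), and it is 1 for v = 1.  Hence Ptilde n / n is
   bounded by the product of 1 + 1/p over the primes dividing n; the primes
   above log n contribute a factor tending to 1, and the product over p <= log n
   is asymptotic to 6/pi^2 e^gamma log log n by Mertens' third theorem and
   zeta(2) = pi^2/6.  The squares of the primorials attain this order.

   Mertens' third theorem is obtained by a Tauberian comparison with the
   harmonic series.  Let B_i be the sum of - ln (1 - 1/p) over 2^i < p <= 2^(i+1)
   and c_i = B_i - 1/(i+1).  With x = 1 - 1/N and x = 2^-d, the Euler product of
   zeta(1+d) and the bounds 1/d <= zeta(1+d) <= 1 + 1/d give
   \sum c_i x^(i+1) = ln (ln 2) + o(1); no value of Gamma' is needed, since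
   \sum x^(i+1) / (i+1) = ln N is the same transform of the harmonic series.
   Mertens' first theorem is Tauber's condition \sum_(i < N) (i+1) c_i = o(N),
   so \sum_(i < N) c_i tends to ln (ln 2) too. *)
Require Import Defs.
From mathcomp Require Import all_boot all_order all_algebra.
From mathcomp Require Import all_classical all_reals all_analysis.
From mathcomp Require Import zify ring lra.
Import Order.TTheory GRing.Theory Num.Theory.
Import numFieldNormedType.Exports.
Local Open Scope ring_scope.
Local Open Scope classical_set_scope.

(** * Sieving and Euler products *)

Lemma cvg_seq_comp {R : realType} (u : nat -> R) (l : R) (g : nat -> nat) :
  (forall N, \forall n \near \oo, (N <= g n)%N) ->
  u n @[n --> \oo] --> l -> u (g n) @[n --> \oo] --> l.
Proof. by move=> h ul; apply: (cvg_comp g u _ ul); exact/cvgnyPge. Qed.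

(** Monotonicity squeezes [u n] between its values at the two multiples [n %/ k * k] and [n * k] of
    [k]. *)
Lemma nondecreasing_mul_cvg {R : realType} (u : nat -> R) (l : R) (k : nat) :
  (0 < k)%N -> {homo u : m n / (m <= n)%N >-> m <= n} ->
  u (n * k)%N @[n --> \oo] --> l -> u n @[n --> \oo] --> l.
Proof.
move=> k0 uh ul.
apply: (@squeeze_cvgr _ _ _ _ (fun n => u (n %/ k * k)%N) (fun n => u (n * k)%N)).
- by near=> n; rewrite !uh ?leq_divM ?leq_pmulr.
- apply: (cvg_seq_comp (fun n => u (n * k)%N) l (fun n => n %/ k)%N _ ul) => N.
  by near=> n; rewrite leq_divRL//; near: n; exact: nbhs_infty_ge.
- exact: ul.
Unshelve. all: by end_near.
Qed.

(** The [y]-rough numbers: the primes sieved out are those strictly below [y]. Positivity is imposed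
    separately, since 0 passes the test as long as no prime is below [y]. *)
Definition rough (y n : nat) : bool :=
  (0 < n)%N && all (fun p => ~~ (prime p && (p %| n)%N)) (iota 0 y).

Lemma rough0 n : rough 0 n = (0 < n)%N. Proof. by rewrite /rough andbT. Qed.

Lemma roughS y n : rough y.+1 n = rough y n && ~~ (prime y && (y %| n)%N).
Proof. by rewrite /rough -[y.+1]addn1 iotaD all_cat /= add0n andbT andbA. Qed.

Lemma rough1 y : rough y 1.
Proof.
rewrite /rough /=; apply/allP => p _; rewrite dvdn1.
by case: eqP => [->|]; rewrite ?andbF.
Qed.

(** The least prime factor of a smaller [n] would itself be below [y]. *)
Lemma rough_ge y n : rough y n -> (1 < n)%N -> (y <= n)%N.
Proof.
move=> /andP[n0 /allP h] n1; rewrite leqNgt; apply/negP => ny.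
have pn : (pdiv n <= n)%N by apply: pdiv_leq.
have := h (pdiv n); rewrite mem_iota /= add0n (leq_ltn_trans pn ny).
by move=> /(_ isT); rewrite pdiv_prime// pdiv_dvd.
Qed.

Lemma rough_mul y m : prime y -> rough y (m * y) = rough y m.
Proof.
move=> yp; rewrite /rough muln_gt0 (prime_gt0 yp) andbT; congr (_ && _).
apply: eq_in_all => p; rewrite mem_iota add0n /= => py.
case pp : (prime p) => //=; rewrite Gauss_dvdl//.
rewrite prime_coprime// dvdn_prime2//; apply/eqP => e.
by rewrite e ltnn in py.
Qed.

Section Sieve.
Context {R : realType} (f : nat -> R) (Z : R).
Hypotheses (fM : forall m n, f (m * n)%N = f m * f n) (f_ge0 : forall n, 0 <= f n).
Hypotheses (f0 : f 0 = 0) (f1 : f 1 = 1).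
Hypothesis fZ : (\sum_(0 <= n < N) f n) @[N --> \oo] --> Z.

(** Each block of [y] consecutive integers starting at a multiple of [y] holds a single multiple of
    [y]. Complete multiplicativity pulls out [f y], and by [rough_mul] the cofactor satisfies the
    same sieve condition. *)
Lemma sum_rough_mul y M : prime y ->
  \sum_(0 <= n < M * y | rough y n && (y %| n)%N) f n
  = f y * \sum_(0 <= n < M | rough y n) f n.
Proof.
move=> yp; have y0 := prime_gt0 yp.
rewrite big_mkcond big_nat_mul big_distrr/= [RHS]big_mkcond/=.
apply: eq_bigr => i _.
rewrite big_ltn ?ltn_mul2r ?ltnSn ?y0// dvdn_mull// andbT rough_mul// fM mulrC.
rewrite big_nat big1 ?addr0// => j /andP[ij ji].
have /negbTE-> : ~~ (y %| j)%N; last by rewrite andbF.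
apply/negP => /dvdnP[k kE]; move: ij ji; rewrite kE ltn_mul2r ltn_mul2r y0 /=.
lia.
Qed.

Lemma sum_rough_homo y :
  {homo (fun N => \sum_(0 <= n < N | rough y n) f n) : m n / (m <= n)%N >-> m <= n}.
Proof.
move=> m n mn /=; rewrite (@big_cat_nat _ _ _ m 0 n)//= lerDl sumr_ge0//.
Qed.

(* Sieving out one more prime y subtracts f y times the sum itself. *)
Lemma sum_rough_cvg y : (\sum_(0 <= n < N | rough y n) f n) @[N --> \oo]
  --> Z * \prod_(0 <= p < y | prime p) (1 - f p).
Proof.
elim: y => [|y IH].
  rewrite big_geq// mulr1; apply: cvg_trans fZ; apply: near_eq_cvg.
  near=> N; rewrite [RHS]big_mkcond; apply: eq_bigr => n _ /=.
  by rewrite rough0; case: n.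
have [yp|ynp] := boolP (prime y); last first.
  rewrite big_mkcond big_nat_recr//= -big_mkcond (negbTE ynp) mulr1.
  rewrite (_ : (fun N => _) = (fun N => \sum_(0 <= n < N | rough y n) f n))//.
  apply/funext => N; apply: eq_bigl => n.
  by rewrite roughS (negbTE ynp) andbT.
(* The multiples of [y] are accounted for exactly only below a bound of the form [N * y]; the sums
   being monotone, convergence along such bounds suffices. *)
apply: (nondecreasing_mul_cvg _ _ y (prime_gt0 yp) (sum_rough_homo _)).
rewrite big_mkcond big_nat_recr//= -big_mkcond yp mulrA.
rewrite (_ : (fun N => _) = (fun N => \sum_(0 <= n < N * y | rough y n) f n -
   f y * \sum_(0 <= n < N | rough y n) f n)); last first.
  apply/funext => N; rewrite -sum_rough_mul//.
  rewrite [in RHS](bigID (fun n => y %| n)%N)/= addrC addrK.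
  by apply: eq_bigl => n; rewrite roughS yp.
rewrite mulrBr mulr1 [_ * f y]mulrC; apply: cvgB; last exact: cvgMl_tmp.
apply: (cvg_seq_comp _ _ (fun n => n * y)%N _ IH) => N.
near=> n; rewrite (@leq_trans n)// ?leq_pmulr ?prime_gt0//.
by near: n; exact: nbhs_infty_ge.
Unshelve. all: by end_near.
Qed.

(** The middle term is the sum of [f] over all [y]-rough numbers. It contains [f 1 = 1], and every
    other rough number is at least [y], so the rest is dominated by the tail of the series. *)
Lemma sieve_bounds y : (1 < y)%N ->
  1 <= Z * \prod_(0 <= p < y | prime p) (1 - f p)
    <= 1 + (Z - \sum_(0 <= n < y) f n).
Proof.
move=> y1; have := sum_rough_cvg y => h.
apply/andP; split.
  apply: (cvgr_to_ge h); near=> N.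
  have N2 : (1 < N)%N by near: N; exact: nbhs_infty_gt.
  rewrite big_mkcond/= (bigD1_seq 1%N) ?iota_uniq ?mem_index_iota//= rough1 f1.
  by rewrite lerDl sumr_ge0// => i _; case: ifP.
apply: (ler_cvg_to h).
  by apply: cvgD; [exact: cvg_cst|apply: cvgB; [exact: fZ|exact: cvg_cst]].
near=> N.
have N2 : (y <= N)%N by near: N; exact: nbhs_infty_ge.
have E : \sum_(0 <= n < N) f n = \sum_(0 <= n < y) f n + \sum_(y <= n < N) f n.
  exact: big_cat_nat.
rewrite [leRHS](_ : _ = 1 + (\sum_(0 <= n < N) f n - \sum_(0 <= n < y) f n))//.
rewrite [leRHS](_ : _ = 1 + \sum_(y <= n < N) f n); last first.
  by rewrite E addrAC subrr add0r.
rewrite (@big_cat_nat _ _ _ y 0 N)//= lerD//; last first.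
  by rewrite big_mkcond ler_sum// => i _; case: ifP.
rewrite big_mkcond/= (bigD1_seq 1%N) ?iota_uniq ?mem_index_iota//= rough1 f1.
rewrite big_nat_cond big1 ?addr0// => i /andP[/andP[_ iy] i1].
case: ifP => // ri; case: i i1 iy ri => [//|[//|i]] _ iy ri.
by have := rough_ge y _ ri isT; rewrite leqNgt iy.
Unshelve. all: by end_near.
Qed.

Lemma euler_product_cvg :
  Z * \prod_(0 <= p < y | prime p) (1 - f p) @[y --> \oo] --> (1 : R).
Proof.
apply: (@squeeze_cvgr _ _ _ _ (cst 1) (fun y => 1 + (Z - \sum_(0 <= n < y) f n))).
- by near=> y; apply: sieve_bounds; near: y; exact: nbhs_infty_gt.
- exact: cvg_cst.
- rewrite -[X in _ --> X]addr0 -[X in _ --> _ + X](subrr Z).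
  by apply: cvgD; [exact: cvg_cst|apply: cvgB; [exact: cvg_cst|exact: fZ]].
Unshelve. all: by end_near.
Qed.
End Sieve.

(** * Logarithms and the zeta function near 1 *)

Lemma ln_leB1 {R : realType} (x : R) : 0 < x -> ln x <= x - 1.
Proof. by move=> x0; have := @le_ln1Dx R (x - 1); rewrite [1 + _]addrC subrK; apply; lra. Qed.

Lemma ln_ge1BV {R : realType} (x : R) : 0 < x -> 1 - x^-1 <= ln x.
Proof.
move=> x0; have := @ln_leB1 R x^-1; rewrite invr_gt0 => /(_ x0).
by rewrite lnV ?posrE//; lra.
Qed.

Lemma ler_ln_nat {R : realType} (m n : nat) : (0 < m)%N -> (m <= n)%N ->
  ln (m%:R : R) <= ln n%:R.
Proof. by move=> m0 mn; rewrite ler_ln ?posrE ?ltr0n ?ler_nat//; lia. Qed.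

Lemma ln_nat_ge {R : realType} (A : R) : \forall n \near \oo, A <= ln n%:R.
Proof.
near=> n.
have h : expR A <= n%:R by near: n; exact: nbhs_infty_ger.
rewrite -[A]expRK ler_ln ?posrE ?expR_gt0//.
by rewrite (lt_le_trans _ h) ?expR_gt0.
Unshelve. all: by end_near.
Qed.

Lemma ln_succ_bounds {R : realType} (n : nat) : (0 < n)%N ->
  (n.+1%:R^-1 : R) <= ln (n.+1%:R : R) - ln (n%:R : R) <= n%:R^-1.
Proof.
move=> n0; have n0' : (0 : R) < n%:R by rewrite ltr0n.
have n1' : (0 : R) < n.+1%:R by rewrite ltr0n.
rewrite -ln_div ?posrE//.
have q0 : (0 : R) < n.+1%:R / n%:R by rewrite divr_gt0.
have E : (n.+1%:R : R) = n%:R + 1 by rewrite -addn1 natrD.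
apply/andP; split.
  apply: le_trans (ln_ge1BV _ q0); rewrite invf_div E le_eqVlt; apply/orP; left.
  by apply/eqP; field; rewrite -?E !gt_eqF.
apply: le_trans (ln_leB1 _ q0) _; rewrite E le_eqVlt; apply/orP; left.
by apply/eqP; field; rewrite !gt_eqF.
Qed.

Section Zeta.
Context {R : realType} (d : R) (d0 : 0 < d).
Let f (n : nat) : R := n%:R `^ (- (1 + d)).

Lemma zeta_termM m n : f (m * n)%N = f m * f n.
Proof. by rewrite /f natrM powRM. Qed.

Lemma zeta_term0 : f 0 = 0.
Proof. by rewrite /f powR0// oppr_eq0 gt_eqF// addr_gt0. Qed.

Lemma zeta_term1 : f 1 = 1. Proof. by rewrite /f powR1. Qed.

Lemma zeta_term_ge0 n : 0 <= f n. Proof. exact: powR_ge0. Qed.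

Lemma zeta_termE n : (0 < n)%N -> f n = n%:R `^ (- d) / n%:R.
Proof.
move=> n0; rewrite /f opprD addrC powRD; last by rewrite pnatr_eq0 -lt0n n0 implybT.
by rewrite powR_inv1.
Qed.

(** Discrete comparison with the integral of [d * t^(-1-d)], whose primitive is [- t^(-d)]. Both
    sides come from [1 + u <= e^u], at [u = d L] and [u = - d L], where [L = ln (n+1) - ln n] lies
    between [1/(n+1)] and [1/n]. *)
Lemma zeta_term_bounds n : (0 < n)%N ->
  d * f n.+1 <= n%:R `^ (- d) - n.+1%:R `^ (- d) <= d * f n.
Proof.
move=> n0; have /andP[L1 L2] := @ln_succ_bounds R n n0.
have a0 : (0 : R) < n%:R by rewrite ltr0n.
have b0 : (0 : R) < n.+1%:R by rewrite ltr0n.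
have := @expR_ge1Dx R (d * (ln n.+1%:R - ln n%:R)).
have := @expR_ge1Dx R (- (d * (ln n.+1%:R - ln n%:R))).
rewrite !zeta_termE//; set L := _ - _ in L1 L2 *.
have Ea : (n%:R : R) `^ (- d) = n.+1%:R `^ (- d) * expR (d * L).
  by rewrite /powR !gt_eqF// -expRD; congr expR; rewrite /L; ring.
have Eb : (n.+1%:R : R) `^ (- d) = n%:R `^ (- d) * expR (- (d * L)).
  by rewrite Ea -mulrA -expRD subrr expR0 mulr1.
move=> e1 e2; apply/andP; split.
  rewrite Ea mulrCA -[X in _ <= _ - X]mulr1 -mulrBr ler_pM2l ?powR_gt0//.
  by rewrite lerBrDl (le_trans _ e2)// lerD2l ler_pM2l.
rewrite Eb mulrCA -[X in X - _ <= _]mulr1 -mulrBr ler_pM2l ?powR_gt0//.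
have : d * L <= d / n%:R by rewrite ler_pM2l.
by move: e1; move: (expR (- (d * L))) (d * L) (d / n%:R) => u v w; lra.
Qed.

Lemma zeta_sum_le N : \sum_(0 <= n < N.+2) f n
  <= 1 + (1 - N.+1%:R `^ (- d)) / d.
Proof.
elim: N => [|N IH].
  by rewrite !big_nat_recl// big_geq// zeta_term0 zeta_term1 powR1 subrr mul0r !addr0 add0r.
rewrite big_nat_recr//=.
have /andP[h _] := zeta_term_bounds N.+1 isT.
have : f N.+2 <= (N.+1%:R `^ (- d) - N.+2%:R `^ (- d)) / d.
  by rewrite ler_pdivlMr// mulrC.
move: IH; rewrite !mulrBl; lra.
Qed.

Lemma zeta_sum_ge N : (1 - N.+1%:R `^ (- d)) / d <= \sum_(0 <= n < N.+1) f n.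
Proof.
elim: N => [|N IH].
  by rewrite big_nat1 powR1 subrr mul0r zeta_term0.
rewrite big_nat_recr//=.
have /andP[_ h] := zeta_term_bounds N.+1 isT.
have : (N.+1%:R `^ (- d) - N.+2%:R `^ (- d)) / d <= f N.+1.
  by rewrite ler_pdivrMr// mulrC.
move: IH; rewrite !mulrBl; lra.
Qed.

Lemma zeta_cvg : exists2 Z : R,
  (\sum_(0 <= n < N) f n) @[N --> \oo] --> Z & d^-1 <= Z <= 1 + d^-1.
Proof.
have ub N : \sum_(0 <= n < N) f n <= 1 + d^-1.
  have h : \sum_(0 <= n < N) f n <= \sum_(0 <= n < N.+2) f n.
    rewrite [leRHS](@big_cat_nat _ _ _ N 0 N.+2) ?leqW//= lerDl sumr_ge0// => i _.
    exact: zeta_term_ge0.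
  apply: le_trans h (le_trans (zeta_sum_le N) _).
  by rewrite lerD2l ler_pdivrMr// mulVf ?gt_eqF// gerBl powR_ge0.
have nd : {homo (fun N => \sum_(0 <= n < N) f n) : m n / (m <= n)%N >-> m <= n}.
  move=> m n mn; rewrite [leRHS](@big_cat_nat _ _ _ m 0 n)//= lerDl sumr_ge0// => i _.
  exact: zeta_term_ge0.
have cv : cvgn (fun N => \sum_(0 <= n < N) f n).
  apply: nondecreasing_is_cvgn => //.
  by exists (1 + d^-1) => _ [N _ <-]; exact: ub.
exists (limn (fun N => \sum_(0 <= n < N) f n)) => //; apply/andP; split; last first.
  by apply: limr_le => //; near=> N; exact: ub.
apply/ler_addgt0Pr => e e0; near \oo => N.
have h := nondecreasing_cvgn_le nd cv N.+1.
have h2 := zeta_sum_ge N.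
(* The telescoped lower bound falls short of [1/d] by [(N+1)^(-d) / d], which is at most [e] for
   large [N]. *)
suff : (N.+1%:R : R) `^ (- d) <= d * e.
  have -> : d^-1 = (1 - N.+1%:R `^ (- d)) / d + N.+1%:R `^ (- d) / d.
    by rewrite -mulrDl subrK mul1r.
  move=> h3; have : N.+1%:R `^ (- d) / d <= e by rewrite ler_pdivrMr// mulrC.
  lra.
have : - ln (d * e) / d <= ln N.+1%:R.
  have N0 : (0 < N)%N by near: N; exact: nbhs_infty_gt.
  apply: (@le_trans _ _ (ln N%:R)); last exact: ler_ln_nat.
  by near: N; exact: ln_nat_ge.
rewrite ler_pdivrMr// => h3.
rewrite /powR pnatr_eq0/= -[leRHS]lnK ?posrE ?mulr_gt0// ler_expR.
by rewrite mulNr lerNl [d * ln _]mulrC.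
Unshelve. all: by end_near.
Qed.

End Zeta.

(** * The Basel problem *)

Section Basel.
Context {R : realType}.
Implicit Types x : R.

Lemma sin_le_id x : 0 <= x -> sin x <= x.
Proof.
rewrite le_eqVlt => /predU1P[<-|x0]; first by rewrite sin0.
have [|c _] := @MVT R sin cos 0 x x0 (fun y _ => is_derive_sin y).
  by apply: derivable_within_continuous => y _; exact: derivable_sin.
by rewrite sin0 !subr0 => ->; rewrite ger_pMl// cos_le1.
Qed.

Lemma id_le_tan x : 0 <= x < pi / 2 -> x <= tan x.
Proof.
move=> /andP[]; rewrite le_eqVlt => /predU1P[<-|x0] xpi; first by rewrite tan0.
have c0 y : y \in `[0, x]%R -> 0 < cos y.
  rewrite in_itv/= => /andP[y0 yx]; apply: cos_gt0_pihalf.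
  by rewrite (le_lt_trans yx)// andbT (lt_le_trans _ y0)// oppr_lt0 divr_gt0// pi_gt0.
have [||c] := @MVT R tan (fun y => (cos y)^-2) 0 x x0.
- move=> y /subset_itv_oo_cc yx; apply: is_derive_tan.
  by rewrite gt_eqF// c0.
- apply: derivable_within_continuous => y yx; apply: derivable_tan.
  by rewrite gt_eqF// c0.
move=> /subset_itv_oo_cc cx; rewrite tan0 !subr0 => ->.
rewrite ler_peMl ?(ltW x0)// invf_ge1 ?exprn_gt0 ?c0//.
Qed.

(** From [sin x <= x <= tan x], since [1/sin^2 = 1/tan^2 + 1]. *)
Lemma inv_sin2_bounds x : 0 < x < pi / 2 ->
  (x ^+ 2)^-1 <= (sin x ^+ 2)^-1 <= (x ^+ 2)^-1 + 1.
Proof.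
move=> /andP[x0 xpi].
have s0 : 0 < sin x by apply: sin_gt0_pihalf; rewrite x0.
have c0 : 0 < cos x.
  by apply: cos_gt0_pihalf; rewrite xpi andbT (lt_trans _ x0)// oppr_lt0 divr_gt0// pi_gt0.
have sx := sin_le_id x (ltW x0).
have xt : x <= tan x by apply: id_le_tan; rewrite (ltW x0).
apply/andP; split.
  by rewrite lef_pV2 ?posrE ?exprn_gt0// lerXn2r ?nnegrE// ltW.
have -> : (sin x ^+ 2)^-1 = (tan x ^+ 2)^-1 + 1.
  have -> : (tan x ^+ 2)^-1 = cos x ^+ 2 / sin x ^+ 2.
    by rewrite /tan; field; rewrite !gt_eqF.
  rewrite cos2sin2.
  by field; rewrite !gt_eqF.
rewrite lerD2r lef_pV2 ?posrE ?exprn_gt0// ?lerXn2r ?nnegrE//; first exact: ltW.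
  exact: le_trans (ltW x0) xt.
exact: lt_le_trans x0 xt.
Qed.

Lemma inv_sin2_duplication x : sin x != 0 -> cos x != 0 ->
  (sin x ^+ 2)^-1 + (cos x ^+ 2)^-1 = 4 * (sin (x *+ 2) ^+ 2)^-1.
Proof.
move=> s0 c0; rewrite sin_mulr2n -mulr_natl.
have -> : (sin x ^+ 2)^-1 + (cos x ^+ 2)^-1 =
   (cos x ^+ 2 + sin x ^+ 2) / (sin x ^+ 2 * cos x ^+ 2) by field; rewrite s0 c0.
by rewrite cos2Dsin2; field; rewrite s0 c0.
Qed.

(** For [k < 2 ^ n] these are exactly the odd multiples of [pi / 2^(n+2)] in the open first
    quadrant. *)
Let theta (n k : nat) : R := k.*2.+1%:R * pi / 2 ^+ n.+2.

Lemma theta_range n k : (k < 2 ^ n)%N -> 0 < theta n k < pi / 2.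
Proof.
move=> kn; have p0 := pi_gt0 R.
rewrite /theta !mulr_gt0 ?invr_gt0 ?exprn_gt0 ?ltr0n//=.
rewrite ltr_pdivrMr ?exprn_gt0// exprS mulrA divfK ?pnatr_eq0// mulrC ltr_pM2l//.
by rewrite -natrX ltr_nat expnS; lia.
Qed.

(** The reflection in [pi/4] exchanges the two halves of the angles of level [n.+1], so that sines
    over the upper half become cosines over the lower half. *)
Lemma theta_rev n k : (k < 2 ^ n)%N ->
  theta n.+1 (2 ^ n + (2 ^ n - k.+1)) = pi / 2 - theta n.+1 k.
Proof.
move=> kn; rewrite /theta.
have -> : ((2 ^ n + (2 ^ n - k.+1)).*2.+1%:R : R) = 2 ^+ n.+2 - k.*2.+1%:R.
  by rewrite -natrX -natrB; [congr _%:R|]; rewrite !expnS; lia.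
by rewrite !exprS; field; rewrite -natrX pnatr_eq0 expn_eq0.
Qed.

(* Halving the angles quadruples the sum, by the duplication formula; comparing
   1/sin^2 x with 1/x^2 then evaluates the sum of the inverse odd squares. *)
Lemma sum_inv_sin2 n :
  \sum_(0 <= k < 2 ^ n) (sin (theta n k) ^+ 2)^-1 = 2 * 4 ^+ n.
Proof.
elim: n => [|n IH].
  rewrite expn0 big_nat1.
  have /andP[t0 t1] := theta_range 0 0 isT.
  have t2 : theta 0 0 *+ 2 = pi / 2 by rewrite /theta double0 -mulr_natr; field.
  have sc : sin (theta 0 0) = cos (theta 0 0).
    by rewrite -cosBpihalf -t2 mulr2n opprD addrA subrr sub0r cosN.
  have s0 : sin (theta 0 0) != 0 by rewrite gt_eqF// sin_gt0_pihalf// t0.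
  move: (inv_sin2_duplication (theta 0 0) s0); rewrite t2 sin_pihalf -sc expr1n invr1.
  by rewrite /theta => /(_ s0); rewrite mul1r expr0; lra.
rewrite expnS mul2n -addnn (@big_cat_nat _ _ _ (2 ^ n)) ?leq_addr//=.
have -> : \sum_(2 ^ n <= k < 2 ^ n + 2 ^ n) (sin (theta n.+1 k) ^+ 2)^-1 =
    \sum_(0 <= k < 2 ^ n) (sin (theta n.+1 (2 ^ n + (2 ^ n - k.+1))) ^+ 2)^-1.
  rewrite -{1}[(2 ^ n)%N]add0n big_addn addnK big_nat_rev/=.
  by apply: eq_bigr => k _; rewrite add0n addnC.
rewrite -big_split/= exprS mulrCA -IH big_distrr/= big_nat [RHS]big_nat.
apply: eq_bigr => k /= kn; rewrite theta_rev//.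
have -> : sin (pi / 2 - theta n.+1 k) = cos (theta n.+1 k).
  by rewrite -cosBpihalf addrAC subrr add0r cosN.
have kn1 : (k < 2 ^ n.+1)%N by rewrite expnS; lia.
have /andP[t0 t1] := theta_range n.+1 k kn1.
rewrite inv_sin2_duplication.
- congr (_ * (sin _ ^+ 2)^-1); rewrite /theta !exprS -mulr_natr.
  by field; rewrite -natrX pnatr_eq0 expn_eq0.
- by rewrite gt_eqF// sin_gt0_pihalf// t0.
- rewrite gt_eqF// cos_gt0_pihalf// t1 andbT (lt_trans _ t0)//.
  by rewrite oppr_lt0 divr_gt0// pi_gt0.
Qed.

(** The sum of the [1/theta^2] is [16 * 4^n / pi^2] times the sum of inverse odd squares, and
    differs from [2 * 4^n] by at most 1 for each of the [2 ^ n] angles; division gives both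
    constants. *)
Lemma sum_inv_odd_sqr_bounds n :
  pi ^+ 2 / 8 - pi ^+ 2 / 16 / 2 ^+ n
    <= \sum_(0 <= k < 2 ^ n) ((k.*2.+1%:R : R)^-1) ^+ 2 <= pi ^+ 2 / 8.
Proof.
have p0 := pi_gt0 R.
have E : \sum_(0 <= k < 2 ^ n) (theta n k ^+ 2)^-1 =
    16 * 4 ^+ n / pi ^+ 2 * \sum_(0 <= k < 2 ^ n) ((k.*2.+1%:R : R)^-1) ^+ 2.
  rewrite big_distrr/=; apply: eq_bigr => k _.
  rewrite /theta !exprS (_ : 4 ^+ n = (2 ^+ n) ^+ 2); last first.
    by rewrite -exprM mulnC exprM; congr (_ ^+ _); rewrite -natrX.
  move: pi p0 => q q0; field; rewrite ?nat1r !gt_eqF ?ltr0n ?exprn_gt0//.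
have L : \sum_(0 <= k < 2 ^ n) (theta n k ^+ 2)^-1 <= 2 * 4 ^+ n.
  rewrite -sum_inv_sin2 big_nat [leRHS]big_nat ler_sum// => k /= kn.
  by have /andP[] := inv_sin2_bounds _ (theta_range n k kn).
have U : 2 * 4 ^+ n <= \sum_(0 <= k < 2 ^ n) (theta n k ^+ 2)^-1 + 2 ^+ n.
  have -> : (2 ^+ n : R) = \sum_(0 <= k < 2 ^ n) 1.
    by rewrite sumr_const_nat subn0 natrX.
  rewrite -sum_inv_sin2 -big_split/= big_nat [leRHS]big_nat ler_sum// => k /= kn.
  by have /andP[] := inv_sin2_bounds _ (theta_range n k kn).
move: L U; rewrite E {E}; move: (\sum_(0 <= k < 2 ^ n) _) => S.
move: pi p0 => q p0.
have -> : (4 ^+ n : R) = 2 ^+ n * 2 ^+ n by rewrite -exprMn; congr (_ ^+ _); rewrite -natrM.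
have x0 : (0 : R) < 2 ^+ n by rewrite exprn_gt0.
move: (2 ^+ n : R) x0 => x x0 L U.
have q0 : 0 < 16 * (x * x) / q ^+ 2 by rewrite divr_gt0 ?mulr_gt0 ?exprn_gt0.
apply/andP; split; rewrite -(ler_pM2l q0).
  apply: (@le_trans _ _ (2 * (x * x) - x)); last by move: U; lra.
  by rewrite le_eqVlt; apply/orP; left; apply/eqP; field; rewrite !gt_eqF.
apply: le_trans L _; rewrite le_eqVlt; apply/orP; left; apply/eqP; field.
by rewrite !gt_eqF.
Qed.

Lemma rough3E n : rough 3 n = odd n.
Proof. by rewrite !roughS rough0/= dvdn2 negbK; case: n. Qed.

(** Convergence is the case [d = 1] of [zeta_cvg]. Sieving out the prime 2 multiplies the limit by
    [1 - 1/4] and leaves the sum over odd numbers, already known to be [pi^2 / 8]. *)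
Lemma basel : (\sum_(0 <= n < N) ((n%:R : R)^-1) ^+ 2) @[N --> \oo] --> pi ^+ 2 / 6.
Proof.
have [Z + _] := @zeta_cvg R 1 ltr01.
rewrite (_ : (fun N => _) = (fun N => \sum_(0 <= n < N) ((n%:R : R)^-1) ^+ 2)); last first.
  apply/funext => N; apply: eq_bigr => n _.
  by rewrite (_ : 1 + 1 = 2%:R)// powR_invn// exprVn.
move=> h; suff -> : pi ^+ 2 / 6 = Z by [].
pose f n := ((n%:R : R)^-1) ^+ 2.
have fM m n : f (m * n)%N = f m * f n by rewrite /f natrM invfM exprMn.
have f0 : f 0 = 0 by rewrite /f invr0 expr0n.
have f_ge0 n : 0 <= f n by rewrite exprn_ge0// invr_ge0.
have := sum_rough_cvg f Z fM f_ge0 f0 h 3.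
rewrite big_mkcond/= 3?big_nat_recr//= big_geq// !mul1r => h3.
suff h4 : (\sum_(0 <= n < 2 ^ N * 2 | rough 3 n) f n) @[N --> \oo] --> pi ^+ 2 / 8.
  have h5 : (\sum_(0 <= n < 2 ^ N * 2 | rough 3 n) f n) @[N --> \oo] --> Z * (1 - f 2).
    apply: (cvg_seq_comp _ _ (fun N => 2 ^ N * 2)%N _ h3) => M.
    near=> N; rewrite (@leq_trans N)//; first by near: N; exact: nbhs_infty_ge.
    by rewrite (leq_trans (ltnW (ltn_expl N (isT : 1 < 2)%N)))// leq_pmulr.
  have e : pi ^+ 2 / 8 = Z * (1 - f 2) by exact: (cvg_unique (@Rhausdorff R) h4 h5).
  have f2 : 1 - f 2 = 3 / 4 by rewrite /f; field.
  by clear -e f2; rewrite f2 in e; move: (pi ^+ 2) e => q e; lra.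
rewrite (_ : (fun N => _) =
    (fun n => \sum_(0 <= k < 2 ^ n) ((k.*2.+1%:R : R)^-1) ^+ 2)); last first.
  apply/funext => N; rewrite big_mkcond/= big_nat_mul; apply: eq_bigr => k _.
  have k1 : (k * 2 < k.+1 * 2)%N by lia.
  have k2 : ((k * 2).+1 < k.+1 * 2)%N by lia.
  rewrite (big_ltn k1) (big_ltn k2)/= [X in _ + (_ + X)]big_geq; last by lia.
  by rewrite !rough3E/= muln2/= odd_double/= add0r addr0.
apply: (@squeeze_cvgr _ _ _ _ (fun n => pi ^+ 2 / 8 - pi ^+ 2 / 16 / 2 ^+ n) (cst (pi ^+ 2 / 8))).
- by near=> n; exact: sum_inv_odd_sqr_bounds.
- rewrite -[X in _ --> X]subr0; apply: cvgB; first exact: cvg_cst.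
  rewrite -[X in _ --> X](mulr0 (pi ^+ 2 / 16)).
  under eq_fun do rewrite -exprVn.
  by apply: cvgMl_tmp; apply: cvg_expr; rewrite ger0_norm// invf_lt1 ?ltr1n.
- exact: cvg_cst.
Unshelve. all: by end_near.
Qed.

Lemma prod_1BinvSqr_cvg :
  \prod_(0 <= p < y | prime p) (1 - ((p%:R : R)^-1) ^+ 2) @[y --> \oo] --> 6 / pi ^+ 2.
Proof.
have p0 := pi_gt0 R.
pose f n := ((n%:R : R)^-1) ^+ 2.
have fM m n : f (m * n)%N = f m * f n by rewrite /f natrM invfM exprMn.
have f0 : f 0 = 0 by rewrite /f invr0 expr0n.
have f1 : f 1 = 1 by rewrite /f invr1 expr1n.
have f_ge0 n : 0 <= f n by rewrite exprn_ge0// invr_ge0.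
have h := euler_product_cvg f _ fM f_ge0 f0 f1 basel.
have q0 : pi ^+ 2 / 6 != 0 :> R by rewrite gt_eqF// divr_gt0// exprn_gt0.
rewrite (_ : 6 / pi ^+ 2 = (pi ^+ 2 / 6)^-1 * 1); last by rewrite mulr1 invf_div.
rewrite (_ : (fun y => _) = (fun y => (pi ^+ 2 / 6)^-1 *
  ((pi ^+ 2 / 6) * \prod_(0 <= p < y | prime p) (1 - f p)))).
  exact: cvgMl_tmp h.
by apply/funext => y; rewrite mulKf.
Qed.
End Basel.

(** * Chebyshev and Legendre bounds on dyadic blocks *)

Lemma ln_prod {R : realType} (I : Type) (r : seq I) (P : pred I) (F : I -> R) :
  (forall i, P i -> 0 < F i) ->
  ln (\prod_(i <- r | P i) F i) = \sum_(i <- r | P i) ln (F i).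
Proof.
move=> F0; suff [] : ln (\prod_(i <- r | P i) F i) = \sum_(i <- r | P i) ln (F i)
    /\ 0 < \prod_(i <- r | P i) F i by [].
elim/big_rec2 : _ => [|i x y Pi [<- y0]]; first by rewrite ln1.
by rewrite lnM ?posrE ?F0// mulr_gt0 ?F0.
Qed.

Lemma prod_logn (m X : nat) : (0 < m)%N ->
  (forall p, prime p -> (p %| m)%N -> (p < X)%N) ->
  m = (\prod_(0 <= p < X | prime p) p ^ logn p m)%N.
Proof.
move=> m0 mX; rewrite -{1}(partnT m0).
rewrite (@widen_partn (m + X)%N) ?leq_addr//.
have E (F : nat -> nat) (n : nat) : (forall p, prime p -> (p %| m)%N -> (p < n)%N) ->
  (n <= (m + X).+1)%N -> (\prod_(0 <= p < (m + X).+1 | prime p) p ^ logn p m =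
  \prod_(0 <= p < n | prime p) p ^ logn p m)%N.
  move=> mn nX; rewrite (@big_cat_nat _ _ _ n)//=.
  rewrite [X in (_ * X)%N]big_nat_cond [X in (_ * X)%N]big1 ?muln1//.
  move=> p /andP[/andP[np _] pp]; rewrite -[RHS](expn0 p); congr (_ ^ _)%N.
  apply/eqP; rewrite -leqn0 leqNgt logn_gt0 mem_primes pp m0/=.
  by apply/negP => /(mn _ pp); rewrite ltnNge np.
rewrite -(E id)//; last by lia.
rewrite [RHS]big_mkcond; apply: eq_bigr => p _.
by case: ifP => // /negbT pn; rewrite lognE (negbTE pn).
Qed.

Lemma ln_logn {R : realType} (m X : nat) : (0 < m)%N ->
  (forall p, prime p -> (p %| m)%N -> (p < X)%N) ->
  ln (m%:R : R) = \sum_(0 <= p < X | prime p) (logn p m)%:R * ln p%:R.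
Proof.
move=> m0 mX; rewrite {1}(prod_logn m X m0 mX) natr_prod ln_prod; last first.
  by move=> p pp; rewrite ltr0n expn_gt0 prime_gt0.
by apply: eq_bigr => p pp; rewrite natrX lnXn ?ltr0n ?prime_gt0// mulr_natl.
Qed.

(** A crude Stirling estimate; the lower bound passes from [n+1] to [n+2] because
    [(n+1) (ln (n+2) - ln (n+1)) <= 1]. *)
Lemma ln_fact_bounds {R : realType} (n : nat) : (0 < n)%N ->
  n%:R * ln n%:R - n%:R <= ln (n`!%:R : R) <= n%:R * ln n%:R.
Proof.
case: n => // n _; elim: n => [|n /andP[IH1 IH2]].
  by rewrite (_ : (1`! = 1)%N)// ln1 mulr0 sub0r oppr_le0 ler01 lexx.
have /andP[L1 L2] := @ln_succ_bounds R n.+1 isT.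
rewrite factS natrM lnM ?posrE ?ltr0n ?fact_gt0//.
have n0 : (0 : R) < n.+1%:R by rewrite ltr0n.
have E : (n.+2%:R : R) = n.+1%:R + 1 by rewrite -addn1 natrD.
move: L2; rewrite -(ler_pM2l n0) mulfV ?gt_eqF// => L2.
have L3 : ln (n.+1%:R : R) <= ln n.+2%:R by apply: ler_ln_nat.
have L4 := ler_wpM2l (ltW n0) L3.
clear L1 n0; apply/andP; split; move: E L2 L3 L4 IH1 IH2;
  move: (ln (n.+1`!)%:R) => u; move: (ln n.+2%:R) (ln n.+1%:R) => v w;
  move: (n.+2%:R) (n.+1%:R) => y z -> *; lra.
Qed.

Lemma prime_dvd_fact p n : prime p -> (p %| n`!)%N -> (p <= n)%N.
Proof.
move=> pp; elim: n => [|n IH]; first by rewrite fact0 dvdn1 => /eqP ep; rewrite ep in pp.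
by rewrite factS Euclid_dvdM// => /orP[/dvdn_leq->//|/IH/leqW].
Qed.

Lemma sum_inv_expn_le {R : realType} (p K : nat) : (1 < p)%N ->
  \sum_(1 <= k < K.+1) ((p ^ k)%:R^-1 : R) <= (p.-1)%:R^-1.
Proof.
case: p => [//|[//|p]] _ /=.
have p0 : (0 : R) < p.+1%:R by rewrite ltr0n.
have E : (p.+2%:R : R) = p.+1%:R + 1 by rewrite -addn1 natrD.
suff -> : \sum_(1 <= k < K.+1) ((p.+2 ^ k)%:R^-1 : R) =
   (p.+1%:R)^-1 * (1 - (p.+2 ^ K)%:R^-1).
  by rewrite ger_pMr ?invr_gt0// gerBl invr_ge0.
elim: K => [|K IH]; first by rewrite big_geq// expn0 invr1 subrr mulr0.
rewrite big_nat_recr//= IH expnS natrM.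
have q0 : (0 : R) < (p.+2 ^ K)%:R by rewrite ltr0n expn_gt0.
rewrite E; move: (p.+1%:R : R) ((p.+2 ^ K)%:R : R) p0 q0 => x y x0 y0.
by field; rewrite !gt_eqF//; lra.
Qed.

Lemma ln_fact_logn {R : realType} n : ln (n`!%:R : R) =
  \sum_(0 <= p < n.+1 | prime p) (\sum_(1 <= k < n.+1) n %/ p ^ k)%:R * ln p%:R.
Proof.
rewrite (@ln_logn R _ n.+1 (fact_gt0 n)); last by move=> p; exact: prime_dvd_fact.
by apply: eq_bigr => p pp; rewrite logn_fact.
Qed.

Lemma ln_prime_ge0 {R : realType} (p : nat) : prime p -> (0 : R) <= ln p%:R.
Proof. by move=> pp; rewrite ln_ge0// ler1n prime_gt0. Qed.

(** Legendre's formula with the floors dropped; the inverse powers of [p] sum to at most the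
    geometric series [1 / (p - 1)]. *)
Lemma ln_fact_le {R : realType} n :
  ln (n`!%:R : R) <= n%:R * \sum_(0 <= p < n.+1 | prime p) ln p%:R / (p.-1)%:R.
Proof.
rewrite ln_fact_logn big_distrr/= ler_sum// => p pp.
rewrite [leRHS]mulrCA [leLHS]mulrC ler_wpM2l ?ln_prime_ge0//.
apply: (@le_trans _ _ (n%:R * \sum_(1 <= k < n.+1) ((p ^ k)%:R^-1 : R))).
  rewrite natr_sum big_distrr/= ler_sum// => k _.
  rewrite ler_pdivlMr ?ltr0n ?expn_gt0 ?prime_gt0// -natrM ler_nat.
  exact: leq_divM.
by rewrite ler_wpM2l// sum_inv_expn_le// prime_gt1.
Qed.

(** Legendre's formula cut after [k = 1]: replacing the floor of [n / p] by [n / p] costs at most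
    one [ln p] per prime. *)
Lemma sum_ln_prime_div_le {R : realType} n : (0 < n)%N ->
  n%:R * \sum_(0 <= p < n.+1 | prime p) ln p%:R / p%:R <=
    ln (n`!%:R : R) + \sum_(0 <= p < n.+1 | prime p) ln p%:R.
Proof.
move=> n0; rewrite ln_fact_logn -big_split/= big_distrr/= ler_sum// => p pp.
rewrite [leLHS]mulrCA -[X in _ <= _ + X]mul1r -mulrDl [leRHS]mulrC.
rewrite ler_wpM2l ?ln_prime_ge0// ler_pdivrMr ?ltr0n ?prime_gt0//.
rewrite natr1 -natrM ler_nat big_ltn// expn1 ltnW//.
rewrite (@leq_trans ((n %/ p).+1 * p)%N) ?ltn_ceil ?prime_gt0//.
by rewrite leq_mul2r ltnS leq_addr orbT.
Qed.

Lemma leq_bin_expn n k : ('C(n, k) <= 2 ^ n)%N.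
Proof.
elim: n k => [|n IH] [|k]; rewrite ?bin0 ?expn_gt0// binS expnS mul2n -addnn.
by rewrite leq_add.
Qed.

(** A prime in [(n, 2n]] divides [(2n)!] but not [n!], hence divides the central binomial
    coefficient, which is at most [2 ^ (2n)]. *)
Lemma chebyshev_block {R : realType} n :
  \sum_(n.+1 <= p < (n.*2).+1 | prime p) ln (p%:R : R) <= n.*2%:R * ln 2.
Proof.
have C0 : (0 < 'C(n.*2, n))%N by rewrite bin_gt0 -addnn leq_addr.
apply: (@le_trans _ _ (ln ('C(n.*2, n)%:R : R))); last first.
  rewrite mulr_natl -lnXn// -natrX ler_ln_nat//; exact: leq_bin_expn.
have CE : ('C(n.*2, n) * (n`! * n`!) = n.*2`!)%N.
  by rewrite -[RHS](@bin_fact n.*2 n) -addnn ?leq_addr// addnK.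
rewrite (@ln_logn R _ n.*2.+1 C0); last first.
  move=> p pp pC; apply: (@prime_dvd_fact p _ pp); rewrite -CE.
  exact: dvdn_mulr.
rewrite [leRHS](@big_cat_nat _ _ _ n.+1)//=; last by lia.
rewrite -[leLHS]add0r lerD//.
  by rewrite sumr_ge0// => p pp; rewrite mulr_ge0// ln_prime_ge0.
rewrite big_nat_cond [leRHS]big_nat_cond ler_sum// => p /andP[/andP[np pn] pp].
rewrite ler_peMl ?ln_prime_ge0// ler1n logn_gt0 mem_primes pp C0/=.
have : (p %| n.*2`!)%N by apply: dvdn_fact; rewrite prime_gt0//; lia.
rewrite -CE !Euclid_dvdM// => /orP[//|]; rewrite orbb => /(prime_dvd_fact _ _ pp).
by rewrite leqNgt np.
Qed.

(** The blocks are open on the left, so that 2 lies in block 0 and blocks 0 to [N - 1] exhaust the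
    primes up to [2 ^ N]. *)
Definition dyad {R : realType} (F : nat -> R) (i : nat) : R :=
  \sum_((2 ^ i).+1 <= p < (2 ^ i.+1).+1 | prime p) F p.

Section Dyad.
Context {R : realType}.
Implicit Types F G : nat -> R.

Lemma sum_dyad F N :
  \sum_(0 <= p < (2 ^ N).+1 | prime p) F p = \sum_(0 <= i < N) dyad F i.
Proof.
elim: N => [|N IH].
  by rewrite [RHS]big_geq// big_mkcond/= 2?big_nat_recr//= big_geq// !addr0.
rewrite (@big_cat_nat _ _ _ (2 ^ N).+1)//= ?IH; last by rewrite ltnS leq_exp2l.
by rewrite big_nat_recr.
Qed.

Lemma ler_dyad F G i :
  (forall p, prime p -> (2 ^ i < p)%N -> (p <= 2 ^ i.+1)%N -> F p <= G p) ->
  dyad F i <= dyad G i.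
Proof.
move=> FG; rewrite /dyad big_nat_cond [leRHS]big_nat_cond ler_sum// => p.
by move=> /andP[/andP[h1 h2] pp]; apply: FG.
Qed.

Lemma dyadZ (a : R) F i : dyad (fun p => a * F p) i = a * dyad F i.
Proof. by rewrite /dyad big_distrr. Qed.

Lemma dyadD F G i : dyad (fun p => F p + G p) i = dyad F i + dyad G i.
Proof. by rewrite /dyad big_split. Qed.

Lemma dyad_ge0 F i : (forall p, prime p -> 0 <= F p) -> 0 <= dyad F i.
Proof. by move=> F0; rewrite /dyad sumr_ge0. Qed.

Definition euler_log (p : nat) : R := - ln (1 - p%:R^-1).
(** This is the sum of [p^(-k)] over [k >= 2]. It equals [1/(p-1) - 1/p], so it telescopes over
    consecutive integers. *)
Definition inv_mul_pred (p : nat) : R := (p%:R * (p.-1)%:R)^-1.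

Lemma euler_log_bounds p : (1 < p)%N -> p%:R^-1 <= euler_log p <= p%:R^-1 + inv_mul_pred p.
Proof.
case: p => [//|[//|p]] _; rewrite /euler_log /inv_mul_pred /=.
have p0 : (0 : R) < p.+1%:R by rewrite ltr0n.
have E : (p.+2%:R : R) = p.+1%:R + 1 by rewrite -addn1 natrD.
rewrite E; move: (p.+1%:R : R) p0 => x x0.
have q0 : 0 < 1 - (x + 1)^-1.
  by rewrite subr_gt0 invf_lt1//; lra.
have := ln_leB1 _ q0; have := ln_ge1BV _ q0.
have -> : (1 - (x + 1)^-1)^-1 = 1 + (x + 1)^-1 + ((x + 1) * x)^-1.
  by field; rewrite !gt_eqF//; lra.
move: (ln (1 - (x + 1)^-1)) => u; move: ((x + 1)^-1) (((x + 1) * x)^-1) => v w; lra.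
Qed.

Lemma inv_mul_pred_ge0 p : 0 <= inv_mul_pred p. Proof. by rewrite invr_ge0 mulr_ge0. Qed.

Lemma euler_log_ge0 p : prime p -> 0 <= euler_log p.
Proof.
by move=> /prime_gt1 /euler_log_bounds /andP[+ _]; apply: le_trans; rewrite invr_ge0.
Qed.

Lemma dyad_inv_mul_pred_le i : dyad inv_mul_pred i <= (2 ^+ i.+1)^-1.
Proof.
have tel m n : (0 < m)%N -> (m <= n)%N ->
    \sum_(m.+1 <= p < n.+1) inv_mul_pred p = m%:R^-1 - n%:R^-1.
  move=> m0; elim: n => [|n IH]; first by rewrite leqNgt m0.
  rewrite leq_eqVlt => /predU1P[->|mn]; first by rewrite big_geq// subrr.
  rewrite big_nat_recr//= IH// /inv_mul_pred/=.
  have n0 : (0 : R) < n%:R by rewrite ltr0n; lia.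
  have E : (n.+1%:R : R) = n%:R + 1 by rewrite -addn1 natrD.
  rewrite E; move: (n%:R : R) (m%:R^-1 : R) n0 => x y x0.
  by field; rewrite !gt_eqF//; lra.
apply: (@le_trans _ _ (\sum_((2 ^ i).+1 <= p < (2 ^ i.+1).+1) inv_mul_pred p)).
  by rewrite /dyad big_mkcond/= ler_sum// => p _; case: ifP => // _; exact: inv_mul_pred_ge0.
rewrite tel ?expn_gt0 ?leq_exp2l// !natrX exprS.
have x0 : (0 : R) < 2 ^+ i by rewrite exprn_gt0.
rewrite le_eqVlt; apply/orP; left; apply/eqP; field; by rewrite gt_eqF.
Qed.

Lemma ln_dyad_bounds i p : (2 ^ i < p)%N -> (p <= 2 ^ i.+1)%N ->
  i%:R * ln (2 : R) <= ln (p%:R : R) <= i.+1%:R * ln (2 : R).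
Proof.
move=> ip pi; rewrite !mulr_natl -!lnXn// -!natrX.
by rewrite !ler_ln_nat// ?expn_gt0//; lia.
Qed.

Lemma dyad_ln_le i : dyad (fun p => ln (p%:R : R)) i <= 2 ^+ i.+1 * ln 2.
Proof.
by have := @chebyshev_block R (2 ^ i); rewrite -mul2n -expnS natrX.
Qed.

Lemma ln2_gt0 : (0 : R) < ln 2. Proof. by rewrite ln_gt0// ltr1n. Qed.

(** On block [i] one has [ln p >= i ln 2] and [euler_log p <= 1/(p-1) <= 2^(-i)], so
    [i ln 2 * 2^i * euler_log p <= ln p]; Chebyshev's bound on the block then applies. *)
Lemma dyad_euler_log_le i : i%:R * dyad euler_log i <= 2.
Proof.
have l0 := ln2_gt0.
have e0 : (0 : R) < 2 ^+ i by rewrite exprn_gt0.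
have : dyad (fun p => (i%:R * ln 2 * 2 ^+ i) * euler_log p) i <= dyad (fun p => ln p%:R) i.
  apply: ler_dyad => p pp ip pi; have /andP[h _] := ln_dyad_bounds i p ip pi.
  have p1 := prime_gt1 pp.
  have /andP[_ l1] := euler_log_bounds p p1.
  have l2 : euler_log p <= (2 ^+ i)^-1.
    apply: (le_trans l1); rewrite /inv_mul_pred.
    have q0 : (0 : R) < (p.-1)%:R by rewrite ltr0n; lia.
    have -> : (p%:R : R) = (p.-1)%:R + 1 by rewrite natr1 prednK//; lia.
    apply: (@le_trans _ _ (p.-1%:R^-1)).
      rewrite le_eqVlt; apply/orP; left; apply/eqP; field.
      by rewrite !gt_eqF//; lra.
    by rewrite lef_pV2 ?posrE// -natrX ler_nat; lia.
  apply: le_trans h; rewrite -mulrA ler_piMr//; first by rewrite mulr_ge0// ltW.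
  by rewrite mulrC -ler_pdivlMr// div1r.
rewrite dyadZ => h; have := le_trans h (dyad_ln_le i).
have -> : i%:R * ln 2 * 2 ^+ i * dyad euler_log i =
  (2 ^+ i * ln 2) * (i%:R * dyad euler_log i) by ring.
have -> : 2 ^+ i.+1 * ln 2 = (2 ^+ i * ln 2) * 2 :> R by rewrite exprS; ring.
by rewrite ler_pM2l// mulr_gt0.
Qed.

(** The constant is the full sum of [(i+1) / 2^(i+1)]. *)
Lemma sum_dyad_inv_mul_pred_le N : \sum_(0 <= i < N) i.+1%:R * dyad inv_mul_pred i <= 2.
Proof.
have tel : \sum_(0 <= i < N) i.+1%:R / 2 ^+ i.+1 = 2 - N.+2%:R / 2 ^+ N :> R.
  elim: N => [|N IH]; first by rewrite big_geq//; field.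
  rewrite big_nat_recr//= IH exprS -[N.+3]addn1 -[N.+2]addn1 !natrD.
  by field; rewrite -natrX pnatr_eq0 expn_eq0.
apply: (@le_trans _ _ (\sum_(0 <= i < N) i.+1%:R / 2 ^+ i.+1)).
  by rewrite ler_sum// => i _; rewrite ler_wpM2l// dyad_inv_mul_pred_le.
by rewrite tel gerBl divr_ge0// exprn_ge0.
Qed.
End Dyad.

(** * Mertens' first theorem *)

Section Mertens1.
Context {R : realType}.

Lemma ln_expn2_fact_bounds N :
  N%:R * ln 2 - 1 <= ln (((2 ^ N)`!)%:R : R) / 2 ^+ N <= N%:R * ln 2.
Proof.
have e0 : (0 : R) < 2 ^+ N by rewrite exprn_gt0.
have /andP[] := @ln_fact_bounds R (2 ^ N) (expn_gt0 _ _).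
rewrite !natrX lnXn// -[ln _ *+ N]mulr_natl => h1 h2.
rewrite ler_pdivlMr// ler_pdivrMr//; move: h1 h2.
move: (ln ((2 ^ N)`!%:R : R)) (ln (2 : R)) (2 ^+ N : R) (N%:R : R) => a b c d h1 h2.
by apply/andP; split; lra.
Qed.

(** Lower half of Mertens' first theorem, from [ln_fact_le] at [2 ^ N] with [ln p <= (i+1) ln 2] on
    block [i]. The loss is [1 / ln 2] from Stirling and 2 from replacing [1/(p-1)] by
    [euler_log p]. *)
Lemma sum_mul_dyad_euler_log_ge N :
  N%:R - (2 + (ln 2)^-1) <= \sum_(0 <= i < N) i.+1%:R * dyad euler_log i :> R.
Proof.
have l0 := @ln2_gt0 R.
have e0 : (0 : R) < 2 ^+ N by rewrite exprn_gt0.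
have /andP[h1 _] := ln_expn2_fact_bounds N.
have h2 := @ln_fact_le R (2 ^ N).
have : N%:R * ln 2 - 1 <=
    \sum_(0 <= i < N) dyad (fun p => ln (p%:R : R) / (p.-1)%:R) i.
  by apply: (le_trans h1); rewrite ler_pdivrMr// mulrC -natrX -sum_dyad.
have h3 : \sum_(0 <= i < N) dyad (fun p => ln (p%:R : R) / (p.-1)%:R) i <=
    ln 2 * (\sum_(0 <= i < N) i.+1%:R * dyad euler_log i +
            \sum_(0 <= i < N) i.+1%:R * dyad inv_mul_pred i).
  rewrite -big_split/= big_distrr/= ler_sum// => i _.
  rewrite -mulrDr mulrA -dyadD -dyadZ; apply: ler_dyad => p pp ip pi.
  have /andP[_ l1] := @ln_dyad_bounds R i p ip pi.
  have p1 := prime_gt1 pp.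
  have /andP[l2 _] := @euler_log_bounds R p p1.
  have q0 : (0 : R) < (p.-1)%:R by rewrite ltr0n; lia.
  have -> : ((p.-1)%:R^-1 : R) = p%:R^-1 + inv_mul_pred p.
    rewrite /inv_mul_pred (_ : (p%:R : R) = (p.-1)%:R + 1); last by rewrite natr1 prednK//; lia.
    by field; rewrite !gt_eqF//; lra.
  rewrite ler_pM ?ln_prime_ge0 ?addr_ge0 ?inv_mul_pred_ge0 ?invr_ge0// ?lerD2r//.
  by rewrite mulrC.
have h4 := @sum_dyad_inv_mul_pred_le R N.
move=> h; have := le_trans h h3.
have h5 : ln 2 * (\sum_(0 <= i < N) i.+1%:R * dyad euler_log i +
                  \sum_(0 <= i < N) i.+1%:R * dyad inv_mul_pred i)
  <= ln 2 * (\sum_(0 <= i < N) i.+1%:R * dyad euler_log i + 2 : R).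
  by rewrite ler_pM2l// lerD2l.
move=> /le_trans /(_ h5).
have -> : N%:R * ln 2 - 1 = ln 2 * (N%:R - (ln 2)^-1) :> R by field; rewrite gt_eqF.
by rewrite ler_pM2l//; lra.
Qed.

Lemma sum_dyad_ln_le N : \sum_(0 <= i < N) dyad (fun p => ln (p%:R : R)) i <= 2 ^+ N * (2 * ln 2).
Proof.
have l0 := @ln2_gt0 R.
apply: (@le_trans _ _ (\sum_(0 <= i < N) 2 ^+ i.+1 * ln 2)).
  by rewrite ler_sum// => i _; exact: dyad_ln_le.
have -> : \sum_(0 <= i < N) 2 ^+ i.+1 * ln 2 = (2 ^+ N - 1) * (2 * ln 2) :> R.
  elim: (N) => [|n IH]; first by rewrite big_geq// subrr mul0r.
  by rewrite big_nat_recr//= IH !exprS; ring.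
by rewrite ler_wpM2r ?mulr_ge0 ?(ltW l0)// gerBl.
Qed.

(** On block [i] the inequality [ln p >= i ln 2] controls only the weight [i]; raising it to [i.+1]
    adds the last sum, which is shown below to be [o(N)]. The constant 4 is 2 from Chebyshev's bound
    and 2 from [inv_mul_pred]. *)
Lemma sum_mul_dyad_euler_log_le N :
  \sum_(0 <= i < N) i.+1%:R * dyad euler_log i <=
    N%:R + 4 + \sum_(0 <= i < N) dyad euler_log i :> R.
Proof.
have l0 := @ln2_gt0 R.
have e0 : (0 : R) < 2 ^+ N by rewrite exprn_gt0.
have /andP[_ h1] := ln_expn2_fact_bounds N.
have := @sum_ln_prime_div_le R (2 ^ N) (expn_gt0 _ _).
rewrite !sum_dyad natrX => h2.
have h3 := sum_dyad_ln_le N.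
have h4 : \sum_(0 <= i < N) dyad (fun p => ln (p%:R : R) / p%:R) i <= (N%:R + 2) * ln 2.
  rewrite -(ler_pM2l e0); apply: (le_trans h2).
  move: h1; rewrite ler_pdivrMr// => h1; apply: (le_trans (lerD h1 h3)).
  by rewrite le_eqVlt; apply/orP; left; apply/eqP; ring.
have h5 : ln 2 * \sum_(0 <= i < N) i%:R * dyad euler_log i <=
    \sum_(0 <= i < N) dyad (fun p => ln (p%:R : R) / p%:R) i +
    ln 2 * \sum_(0 <= i < N) i.+1%:R * dyad inv_mul_pred i.
  rewrite [X in _ <= _ + X]big_distrr/= -big_split/= big_distrr/= ler_sum// => i _.
  rewrite !mulrA -!dyadZ -dyadD; apply: ler_dyad => p pp ip pi.
  have /andP[l1 l2] := @ln_dyad_bounds R i p ip pi.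
  have /andP[_ l3] := @euler_log_bounds R p (prime_gt1 pp).
  apply: (@le_trans _ _ (ln p%:R * (p%:R^-1 + inv_mul_pred p))).
    by rewrite ler_pM ?euler_log_ge0 ?mulr_ge0 ?(ltW l0)// mulrC.
  by rewrite mulrDr lerD2l ler_wpM2r ?inv_mul_pred_ge0// mulrC.
have h6 : ln 2 * \sum_(0 <= i < N) i.+1%:R * dyad inv_mul_pred i <= ln 2 * 2 :> R.
  by rewrite ler_pM2l// sum_dyad_inv_mul_pred_le.
have h7 : ln 2 * \sum_(0 <= i < N) i%:R * dyad euler_log i <= ln 2 * (N%:R + 4) :> R by lra.
move: h7; rewrite ler_pM2l// => h7.
have -> : \sum_(0 <= i < N) i.+1%:R * dyad euler_log i =
    \sum_(0 <= i < N) i%:R * dyad euler_log i + \sum_(0 <= i < N) dyad euler_log i :> R.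
  by rewrite -big_split/=; apply: eq_bigr => i _; rewrite -natr1 mulrDl mul1r.
by rewrite lerD2r.
Qed.

(** By [dyad_euler_log_le] the blocks from index [2/e] on are at most [e]; the finitely many earlier
    ones make up [K]. *)
Lemma sum_dyad_euler_log_little (e : R) : 0 < e ->
  exists2 K : R, 0 <= K & forall N, \sum_(0 <= i < N) dyad euler_log i <= e * N%:R + K.
Proof.
move=> e0; pose M := (Num.truncn (2 / e)).+1.
have Me : 2 / e <= M%:R by rewrite ltW// truncnS_gt.
have M0 : (0 : R) < M%:R by rewrite ltr0n.
have B0 i : 0 <= dyad euler_log i :> R by rewrite dyad_ge0// => p; exact: euler_log_ge0.
exists (\sum_(0 <= i < M) dyad euler_log i); first by rewrite sumr_ge0.
have Be i : (M <= i)%N -> dyad euler_log i <= e.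
  move=> Mi; have i0 : (0 : R) < i%:R by rewrite ltr0n; lia.
  rewrite -(ler_pM2l i0); apply: (le_trans (dyad_euler_log_le i)).
  have : M%:R * e <= i%:R * e by rewrite ler_pM2r// ler_nat.
  by apply: le_trans; rewrite -ler_pdivrMr.
elim=> [|N IH]; first by rewrite big_geq// mulr0 add0r sumr_ge0.
have [MN|NM] := leqP M N.
  rewrite big_nat_recr//= -natr1; have := Be _ MN; move: IH; lra.
have : \sum_(0 <= i < N.+1) dyad euler_log i <= \sum_(0 <= i < M) dyad euler_log i :> R.
  by rewrite [leRHS](@big_cat_nat _ _ _ N.+1)//= lerDl sumr_ge0.
by apply: (fun a b => le_trans b a); rewrite lerDr mulr_ge0// ltW.
Qed.

(** Primes in block [i] are expected to contribute about [1/(i+1)], since [ln (ln y)] grows by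
    [ln (i+1) - ln i] from [2^i] to [2^(i+1)]. *)
Definition harmonic_gap (i : nat) : R := dyad euler_log i - i.+1%:R^-1.

(** The weight [i.+1] turns the subtracted harmonic terms into [N], the main term in both halves of
    Mertens' first theorem; what remains is Tauber's condition. *)
Lemma sum_mul_harmonic_gap_little (e : R) : 0 < e -> exists2 K : R, 0 <= K &
  forall N, `| \sum_(0 <= i < N) i.+1%:R * harmonic_gap i | <= e * N%:R + K.
Proof.
move=> e0; have [K K0 HK] := sum_dyad_euler_log_little e e0.
have l0 := @ln2_gt0 R.
have l0' : 0 < (ln 2)^-1 :> R by rewrite invr_gt0.
exists (4 + (ln 2)^-1 + K) => [|N]; first by lra.
have -> : \sum_(0 <= i < N) i.+1%:R * harmonic_gap i =
    \sum_(0 <= i < N) i.+1%:R * dyad euler_log i - N%:R.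
  rewrite [X in _ - X](_ : _ = \sum_(0 <= i < N) 1); last by rewrite sumr_const_nat subn0.
  rewrite -sumrB; apply: eq_bigr => i _.
  by rewrite /harmonic_gap mulrBr mulfV ?pnatr_eq0.
have h1 := sum_mul_dyad_euler_log_ge N; have h2 := sum_mul_dyad_euler_log_le N.
have h3 := HK N.
have h4 : 0 <= e * N%:R by rewrite mulr_ge0// ltW.
by rewrite ler_norml; apply/andP; split; lra.
Qed.
End Mertens1.

(** * Tauber's theorem *)

Section Tauber.
Context {R : realType}.

(** The remainder [g] after [M] terms vanishes at 0 and has derivative [y^M / (1 - y)], so the mean
    value theorem bounds it by [x^M / (1 - x)]. *)
Lemma ln_series_cvg (x : R) : 0 <= x < 1 ->
  (\sum_(0 <= i < M) x ^+ i.+1 / i.+1%:R) @[M --> \oo] --> - ln (1 - x).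
Proof.
move=> /andP[x0 x1].
suff H M : 0 <= - ln (1 - x) - \sum_(0 <= i < M) x ^+ i.+1 / i.+1%:R
    <= x ^+ M / (1 - x).
  apply: (@squeeze_cvgr _ _ _ _ (fun M => - ln (1 - x) - x ^+ M / (1 - x))
     (cst (- ln (1 - x)))).
  - by near=> M; have /andP[] := H M; rewrite /cst; lra.
  - rewrite -[X in _ --> X]subr0; apply: cvgB; first exact: cvg_cst.
    rewrite -[X in _ --> X](mul0r (1 - x)^-1); apply: cvgMr_tmp.
    by apply: cvg_expr; rewrite ger0_norm.
  - exact: cvg_cst.
pose g (y : R) := - ln (1 - y) - \sum_(0 <= i < M) y ^+ i.+1 / i.+1%:R.
have dg (y : R) : y < 1 -> is_derive y 1 g (y ^+ M / (1 - y)).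
  move=> y1; rewrite /g.
  have dl : is_derive y 1 (fun y => - ln (1 - y)) ((1 - y)^-1).
    have -> : (fun y : R => - ln (1 - y)) = - (@ln R \o (fun y => 1 - y)) by apply/funext.
    have h1 : is_derive y 1 (fun y : R => 1 - y) (-1).
      rewrite -[X in is_derive _ _ _ X]sub0r; exact: (@is_deriveB R R R (cst 1) id).
    have h2 : is_derive (1 - y) 1 (@ln R) ((1 - y)^-1).
      by apply: is_derive1_ln; rewrite subr_gt0.
    have h3 := @is_derive1_comp R (@ln R) (fun y : R => 1 - y) y _ _ h2 h1.
    rewrite [X in is_derive _ _ _ X](_ : _ = - ((1 - y)^-1 * -1)); last by rewrite mulrN1 opprK.
    exact: is_deriveN.
  elim: (M) => [|m IH].
    rewrite (_ : (fun y => _) = (fun y => - ln (1 - y))).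
      by rewrite expr0 div1r.
    by apply/funext => z; rewrite big_geq// subr0.
  rewrite (_ : (fun y => _) = (fun y => - ln (1 - y) -
     \sum_(0 <= i < m) y ^+ i.+1 / i.+1%:R) - (m.+1%:R^-1 \*: (fun y => y ^+ m.+1))); last first.
    apply/funext => z; rewrite big_nat_recr//= opprD addrA; congr (_ - _).
    by rewrite mulrC.
  have h4 : is_derive y 1 (@GRing.exp R ^~ m.+1) (m.+1%:R * y ^+ m).
    by apply: DeriveDef; [exact: exprn_derivable | rewrite exp_derive [LHS]mulr1].
  rewrite [X in is_derive _ _ _ X]
    (_ : _ = y ^+ m / (1 - y) - m.+1%:R^-1 * (m.+1%:R * y ^+ m)); last first.
    rewrite mulrA mulVf ?pnatr_eq0// mul1r exprS; field.
    by rewrite subr_eq0 eq_sym lt_eqF.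
  by apply: is_deriveB; exact: is_deriveZ.
have g0 : g 0 = 0.
  rewrite /g subr0 ln1 oppr0 sub0r big1 ?oppr0// => i _.
  by rewrite exprS !mul0r.
suff: 0 <= g x <= x ^+ M / (1 - x) by [].
have [->|xn0] := eqVneq x 0.
  by rewrite g0 lexx/= divr_ge0// ?subr0// exprn_ge0.
have xp : 0 < x by rewrite lt_def xn0.
have [||c] := @MVT R g (fun y => y ^+ M / (1 - y)) 0 x xp.
- move=> y; rewrite in_itv/= => /andP[_ yx]; apply: dg; exact: lt_trans yx x1.
- apply: derivable_within_continuous => y; rewrite in_itv/= => /andP[_ yx].
  by apply: ex_derive; apply: dg; exact: le_lt_trans yx x1.
rewrite in_itv/= => /andP[c0 cx]; rewrite g0 !subr0 => ->.
have c1 : 0 < 1 - c by rewrite subr_gt0; exact: lt_trans cx x1.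
have x1' : 0 < 1 - x by rewrite subr_gt0.
apply/andP; split.
  by rewrite mulr_ge0// divr_ge0// ?exprn_ge0// ltW.
apply: (@le_trans _ _ (c ^+ M / (1 - c))).
  by rewrite ler_piMr ?(ltW x1)// divr_ge0 ?exprn_ge0// ltW.
rewrite ler_pM ?exprn_ge0 ?invr_ge0 ?(ltW c0) ?(ltW c1)//.
  by rewrite lerXn2r ?nnegrE ?(ltW c0) ?(ltW cx).
by rewrite lef_pV2 ?posrE// lerB ?(ltW cx).
Unshelve. all: by end_near.
Qed.

(** Summation by parts moves the differences onto the nonincreasing [w]; bounding the partial sums
    by [u N = e N + K] and summing by parts back leaves the boundary term at [a] twice and the
    increment [e] of [u] against each [w i]. *)
Lemma abel_bound (c w : nat -> R) (e K : R) (a b : nat) : 0 <= e -> 0 <= K ->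
  (forall N, `| \sum_(0 <= i < N) i.+1%:R * c i | <= e * N%:R + K) ->
  (forall i, 0 <= w i) ->
  (forall i, (a <= i)%N -> w i.+1 <= w i) -> (a <= b)%N ->
  `| \sum_(a <= i < b) i.+1%:R * c i * w i |
    <= 2 * (e * a%:R + K) * w a + e * \sum_(a <= i < b) w i.
Proof.
move=> e0 K0 tK w0 wd.
pose t N := \sum_(0 <= i < N) i.+1%:R * c i.
pose u N := e * N%:R + K.
have u0 N : 0 <= u N by rewrite addr_ge0// mulr_ge0.
have tS N : N.+1%:R * c N = t N.+1 - t N by rewrite /t big_nat_recr//= addrAC subrr add0r.
have uS N : u N.+1 = u N + e by rewrite /u -natr1 mulrDr mulr1 addrAC.
rewrite leq_eqVlt => /predU1P[<-|].
  by rewrite !big_geq// normr0 mulr0 addr0 !mulr_ge0//; exact: u0.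
case: b => // b; rewrite ltnS => ab.
(* Isolating the boundary term [t b.+1 * w b] and adding its majorant [u b.+1 * w b] makes the
   estimate stable under increasing [b]. *)
suff : `| \sum_(a <= i < b.+1) i.+1%:R * c i * w i - t b.+1 * w b | + u b.+1 * w b
    <= 2 * u a * w a + e * \sum_(a <= i < b.+1) w i.
  apply: le_trans.
  set S := \sum_(a <= i < b.+1) i.+1%:R * c i * w i.
  have := ler_normD (S - t b.+1 * w b) (t b.+1 * w b); rewrite subrK => h.
  apply: (le_trans h); rewrite lerD2l normrM (ger0_norm (w0 b)).
  by rewrite ler_wpM2r//; exact: tK.
have base : `| \sum_(a <= i < a.+1) i.+1%:R * c i * w i - t a.+1 * w a | + u a.+1 * w a
    <= 2 * u a * w a + e * \sum_(a <= i < a.+1) w i.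
  rewrite !big_nat1 tS uS [X in `|X|](_ : _ = - (t a * w a)); last by ring.
  rewrite normrN normrM (ger0_norm (w0 a)).
  have := ler_wpM2r (w0 a) (tK a); rewrite -/(t a) -/(u a).
  move: (`|t a| * w a) (u a) (w a) => z r s; lra.
elim: b ab => [|b IH]; rewrite leq_eqVlt => /predU1P[E|ab].
- by move: base; rewrite E.
- by [].
- by rewrite -E.
have {}IH := IH ab.
rewrite !(@big_nat_recr _ _ _ b.+1 a)/=; try by lia.
move: IH; set S := \sum_(a <= i < b.+1) _; set W := \sum_(a <= i < b.+1) _ => IH.
rewrite tS uS.
have -> : S + (t b.+2 - t b.+1) * w b.+1 - t b.+2 * w b.+1 =
  (S - t b.+1 * w b) + t b.+1 * (w b - w b.+1) by ring.
have h1 := ler_normD (S - t b.+1 * w b) (t b.+1 * (w b - w b.+1)).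
have wb : 0 <= w b - w b.+1 by rewrite subr_ge0 wd.
move: h1; rewrite normrM (ger0_norm wb) => h1.
have := ler_wpM2r wb (tK b.+1); rewrite -/(t b.+1) -/(u b.+1).
move: h1 IH; move: `|S - t b.+1 * w b| `|t b.+1| => p q h1 IH h2.
move: h1 IH h2; move: (u b.+1) (w b) (w b.+1) => r s v; lra.
Qed.
(** Equivalent to the monotonicity in [m] of [(1 - x^m) / m], which is how it is used. *)
Lemma mul_expr_onem_le (x : R) m : 0 <= x <= 1 -> m%:R * x ^+ m * (1 - x) <= 1 - x ^+ m.
Proof.
move=> /andP[x0 x1]; elim: m => [|m IH]; first by rewrite !mul0r expr0 subrr.
have h1 := ler_wpM2l x0 IH.
have h2 : x ^+ m.+1 * (1 - x) <= 1 * (1 - x).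
  by rewrite ler_wpM2r ?subr_ge0// exprn_ile1.
move: h1 h2; rewrite -natr1 exprS; move: (x ^+ m) (m%:R : R) => y z; lra.
Qed.

(** Bernoulli's inequality; at [x = 1 - 1/N] it bounds [(1 - x^m) / m] by [1/N]. *)
Lemma onem_expr_le (x : R) m : 0 <= x <= 1 -> 1 - x ^+ m <= m%:R * (1 - x).
Proof.
move=> /andP[x0 x1]; elim: m => [|m IH]; first by rewrite expr0 subrr mul0r.
have h : x ^+ m * (1 - x) <= 1 * (1 - x).
  by rewrite ler_wpM2r ?subr_ge0// exprn_ile1.
move: IH h; rewrite -natr1 exprS; move: (x ^+ m) (m%:R : R) => y z; lra.
Qed.

Lemma sum_geom_le (x : R) a b : 0 <= x < 1 ->
  \sum_(a <= i < b) x ^+ i.+1 <= (1 - x)^-1.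
Proof.
move=> /andP[x0 x1]; have x1' : 0 < 1 - x by rewrite subr_gt0.
have [ab|/ltnW ba] := leqP a b; last by rewrite big_geq// invr_ge0 ltW.
apply: (@le_trans _ _ (\sum_(0 <= i < b) x ^+ i.+1)).
  by rewrite [leRHS](@big_cat_nat _ _ _ a)//= lerDr sumr_ge0// => i _; rewrite exprn_ge0.
rewrite -[leRHS]mul1r ler_pdivlMr//.
suff -> : (\sum_(0 <= i < b) x ^+ i.+1) * (1 - x) = x - x ^+ b.+1.
  by rewrite lerBlDr (le_trans (ltW x1))// lerDl exprn_ge0.
elim: (b) => [|n IH]; first by rewrite big_geq// mul0r expr1 subrr.
by rewrite big_nat_recr//= mulrDl IH [x ^+ n.+2]exprS; ring.
Qed.

(* Abel summation is applied with the weights (1 - x^m)/m for m <= N and x^m/m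
   for m > N, both nonincreasing, where x = 1 - 1/N and m = i + 1. *)
Lemma tauber (c : nat -> R) :
  (forall e, 0 < e -> exists2 K : R, 0 <= K &
    forall N, `| \sum_(0 <= i < N) i.+1%:R * c i | <= e * N%:R + K) ->
  forall e, 0 < e -> \forall N \near \oo, forall M, (N <= M)%N ->
  `| \sum_(0 <= i < N) c i - \sum_(0 <= i < M) c i * (1 - N%:R^-1) ^+ i.+1 | <= e.
Proof.
(* The budget is [e/4] for the boundary term at 0, [e/2] for the one at [N], and [e/8] for each of
   the two sums of weights, which are at most 1. *)
move=> tc e e0; have e8 : 0 < e / 8 by rewrite divr_gt0.
have [K K0 tK] := tc _ e8.
near=> N => M NM.
have N1 : (1 < N)%N by near: N; exact: nbhs_infty_gt.
have N0 : (0 : R) < N%:R by rewrite ltr0n; lia.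
have KN : 8 * K / e <= N%:R by near: N; exact: nbhs_infty_ger.
have KN' : K / N%:R <= e / 8.
  rewrite ler_pdivrMr//; move: KN; rewrite ler_pdivrMr// => h.
  by move: h; move: (N%:R : R) => n; lra.
set x := 1 - N%:R^-1.
have Nx : 1 - x = N%:R^-1 by rewrite /x opprB addrC subrK.
have x0 : 0 <= x by rewrite subr_ge0 invf_le1// ler1n ltnW.
have x1 : x < 1 by rewrite gtrBl invr_gt0.
have x01 : 0 <= x <= 1 by rewrite x0 ltW.
have I0 i : 0 <= (i.+1%:R^-1 : R) by rewrite invr_ge0.
pose w1 i : R := (1 - x ^+ i.+1) / i.+1%:R.
pose w2 i : R := x ^+ i.+1 / i.+1%:R.
have w1_ge0 i : 0 <= w1 i.
  by rewrite mulr_ge0// subr_ge0 exprn_ile1// ltW.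
have w2_ge0 i : 0 <= w2 i by rewrite mulr_ge0// exprn_ge0.
have w1S i : (0 <= i)%N -> w1 i.+1 <= w1 i.
  move=> _; rewrite /w1 ler_pdivrMr// mulrAC ler_pdivlMr//.
  have := mul_expr_onem_le x i.+1 x01; rewrite -[i.+2%:R]natr1 [x ^+ i.+2]exprS.
  move: (x ^+ i.+1) (i.+1%:R : R) => y z; lra.
have w2S i : (N <= i)%N -> w2 i.+1 <= w2 i.
  move=> _; rewrite /w2 ler_pM ?exprn_ge0//.
    by rewrite [leLHS]exprS ler_piMl ?exprn_ge0// ltW.
  by rewrite lef_pV2 ?posrE// ler_nat.
have a1 := abel_bound c w1 (e / 8) K 0 N (ltW e8) K0 tK w1_ge0 w1S (leq0n _).
have a2 := abel_bound c w2 (e / 8) K N M (ltW e8) K0 tK w2_ge0 w2S NM.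
have b1 : \sum_(0 <= i < N) w1 i <= 1.
  apply: (@le_trans _ _ (\sum_(0 <= i < N) N%:R^-1)).
    rewrite ler_sum// => i _; rewrite /w1 ler_pdivrMr// mulrC -Nx.
    exact: onem_expr_le.
  by rewrite sumr_const_nat subn0 -[N%:R^-1 *+ N]mulr_natl mulfV ?gt_eqF.
have b2 : \sum_(N <= i < M) w2 i <= 1.
  apply: (@le_trans _ _ (\sum_(N <= i < M) x ^+ i.+1 * N%:R^-1)).
    rewrite big_nat [leRHS]big_nat ler_sum// => i /andP[Ni _].
    by rewrite ler_wpM2l ?exprn_ge0// lef_pV2 ?posrE// ler_nat leqW.
  rewrite -mulr_suml ler_pdivrMr// mul1r.
  by have := sum_geom_le x N M; rewrite x0 x1 Nx invrK => /(_ isT).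
have b3 : w1 0 = N%:R^-1 by rewrite /w1 expr1 divr1 Nx.
have b4 : w2 N <= N%:R^-1.
  apply: (@le_trans _ _ N.+1%:R^-1).
    by rewrite /w2 ler_piMl// exprn_ile1// ltW.
  by rewrite lef_pV2 ?posrE// ler_nat.
have E : \sum_(0 <= i < N) c i - \sum_(0 <= i < M) c i * x ^+ i.+1 =
  \sum_(0 <= i < N) i.+1%:R * c i * w1 i - \sum_(N <= i < M) i.+1%:R * c i * w2 i.
  rewrite (@big_cat_nat _ _ _ N 0 M)//= opprD addrA -sumrB; congr (_ - _).
    apply: eq_bigr => i _; rewrite /w1; field; by rewrite nat1r pnatr_eq0.
  by apply: eq_bigr => i _; rewrite /w2; field; rewrite nat1r pnatr_eq0.
rewrite E; apply: (le_trans (ler_normB _ _)); apply: (le_trans (lerD a1 a2)).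
rewrite b3 mulr0 add0r.
have q1 : 2 * (e / 8 * N%:R + K) * w2 N <= 2 * (e / 8 * N%:R + K) * N%:R^-1.
  by rewrite ler_wpM2l// mulr_ge0// addr_ge0// mulr_ge0// ltW.
have q2 : 2 * (e / 8 * N%:R + K) * N%:R^-1 = e / 4 + 2 * (K / N%:R).
  by field; rewrite gt_eqF.
have q3 : e / 8 * \sum_(0 <= i < N) w1 i <= e / 8 by rewrite ler_piMr// ltW.
have q4 : e / 8 * \sum_(N <= i < M) w2 i <= e / 8 by rewrite ler_piMr// ltW.
rewrite -[2 * K / N%:R]mulrA; lra.
Unshelve. all: by end_near.
Qed.
End Tauber.

(** * Mertens' third theorem *)

Section Mertens3.
Context {R : realType}.

(* For t = p^-d, compares the factor of p in the Euler product of zeta (1 + d)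
   with p^-d times its value at d = 0. *)
Lemma euler_log_scale_bounds (p : nat) (t : R) : (1 < p)%N -> 0 <= t <= 1 ->
  - ln (1 - t / p%:R) <= t * euler_log p <= - ln (1 - t / p%:R) + (1 - t) * inv_mul_pred p.
Proof.
move=> p1 /andP[t0 t1].
have /andP[l1 _] := @euler_log_bounds R p p1.
have p0 : (0 : R) < p%:R by rewrite ltr0n; lia.
have pp : (0 : R) < (p.-1)%:R by rewrite ltr0n; lia.
have pE : (p%:R : R) = (p.-1)%:R + 1 by rewrite natr1 prednK//; lia.
have rE : inv_mul_pred p = (p.-1)%:R^-1 - p%:R^-1 :> R.
  rewrite /inv_mul_pred pE; move: ((p.-1)%:R : R) pp => z z0.
  by field; rewrite !gt_eqF//; lra.
have v1 : (p%:R^-1 : R) < 1 by rewrite invf_lt1// ltr1n.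
have v0 : (0 : R) < p%:R^-1 by rewrite invr_gt0.
rewrite /euler_log in l1 *; set v := (p%:R^-1 : R) in l1 v0 v1 rE *.
have q0 : 0 < 1 - v by rewrite subr_gt0.
have tv : t * v <= v by rewrite ler_piMl// ltW.
have A0 : 0 < 1 - t * v by lra.
have qE : ((1 - v)^-1 : R) = 1 + (p.-1)%:R^-1.
  rewrite /v pE; move: ((p.-1)%:R : R) pp => z z0.
  by field; rewrite !gt_eqF//; lra.
apply/andP; split.
  have h1 := ln_leB1 _ (divr_gt0 q0 A0); rewrite ln_div ?posrE// in h1.
  have h2 := ln_leB1 (1 - t * v)^-1; rewrite invr_gt0 lnV ?posrE// in h2.
  have {}h2 := h2 A0.
  have k1 := ler_wpM2l t0 h1.
  have t1' : 0 <= 1 - t by lra.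
  have k2 := ler_wpM2l t1' h2.
  (* Concavity of [ln] at [1 - t v = t (1 - v) + (1 - t)]: the two tangent bounds at this point,
     weighted by [t] and [1 - t], add up to zero. *)
  have : t * ((1 - v) / (1 - t * v) - 1) + (1 - t) * ((1 - t * v)^-1 - 1) = 0.
    by field; rewrite gt_eqF.
  move: k1 k2; move: (ln (1 - v)) (ln (1 - t * v)) => a b.
  move: (t * (_ - 1)) ((1 - t) * (_ - 1)) => c d; lra.
have h1 := ln_leB1 _ (divr_gt0 A0 q0); rewrite ln_div ?posrE// in h1.
have E : (1 - t * v) / (1 - v) - 1 = (1 - t) * (p.-1)%:R^-1.
  have -> : (p.-1)%:R^-1 = (1 - v)^-1 - 1 :> R by rewrite qE addrAC subrr add0r.
  by field; rewrite gt_eqF.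
rewrite E in h1.
have t1' : 0 <= 1 - t by lra.
have h2 := ler_wpM2l t1' l1.
move: h1 h2; rewrite rE; move: (ln (1 - v)) (ln (1 - t * v)) ((p.-1)%:R^-1 : R) => a b c; lra.
Qed.

(** * Abel sums at [x = 1 - 1/N] against the Euler product of zeta at [1 + d] *)

Section FixN.
Variables (N : nat) (N1 : (1 < N)%N).
Let x : R := 1 - N%:R^-1.
(** Chosen so that [2^(-d) = x]; hence [x^(i+1) <= p^(-d) <= x^i] for every prime [p] of block
    [i]. *)
Let d : R := - ln x / ln 2.
Let f (n : nat) : R := n%:R `^ (- (1 + d)).
Let E M := \sum_(0 <= i < M) dyad (fun p => - ln (1 - f p)) i.
Let B M := \sum_(0 <= i < M) dyad euler_log i * x ^+ i.+1 : R.

Let N0 : (0 : R) < N%:R. Proof. by rewrite ltr0n; lia. Qed.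
Let Np0 : (0 : R) < (N.-1)%:R. Proof. by rewrite ltr0n; lia. Qed.
Let NE : (N%:R : R) = (N.-1)%:R + 1. Proof. by rewrite natr1 prednK//; lia. Qed.
Let l0 := @ln2_gt0 R.
Let x0 : 0 < x. Proof. by rewrite subr_gt0 invf_lt1// ltr1n. Qed.
Let x1 : x < 1. Proof. by rewrite gtrBl invr_gt0. Qed.

Let lnx : N%:R^-1 <= - ln x <= (N.-1)%:R^-1.
Proof.
have h1 := ln_leB1 _ x0; have h2 := ln_ge1BV _ x0.
have pp := Np0.
have pE := NE.
have xV : x^-1 = 1 + (N.-1)%:R^-1.
  rewrite /x pE; move: ((N.-1)%:R : R) pp => z z0.
  by field; rewrite !gt_eqF//; lra.
have Nx : x - 1 = - N%:R^-1 by rewrite /x; ring.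
rewrite xV in h2; rewrite Nx in h1; move: h1 h2.
move: (ln x) (N%:R^-1 : R) ((N.-1)%:R^-1 : R) => a b c h1 h2.
by apply/andP; split; lra.
Qed.

Let d0 : 0 < d.
Proof.
rewrite divr_gt0//; have /andP[h _] := lnx.
by rewrite (lt_le_trans _ h)// invr_gt0.
Qed.

(** Thus zeta at [1 + d] is [N ln 2] up to a bounded error, and its logarithm is close to
    [ln N + ln (ln 2)]: this is the origin of [ln (ln 2)]. *)
Let dV : (N.-1)%:R * ln 2 <= d^-1 <= N%:R * ln 2.
Proof.
have /andP[h1 h2] := lnx.
have pp := Np0.
have y0 : 0 < - ln x by rewrite (lt_le_trans _ h1)// invr_gt0.
rewrite /d invf_div ler_pdivlMr// ler_pdivrMr//.
rewrite [X in X <= _]mulrAC [X in _ && (_ <= X)]mulrAC.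
rewrite -[X in (_ <= X) && _]mul1r -[X in _ && (X <= _)]mul1r !ler_pM2r//.
by rewrite -ler_pdivlMl// mulr1 h2/= -ler_pdivrMl// mulr1.
Qed.

(** With [t = p^(-d)], replacing [t] by [x^(i+1)] costs at most a factor [x] below and nothing
    above. The upper error is [(1 - x^(i+1)) * inv_mul_pred p], at most [(i+1)/N] times
    [inv_mul_pred p], and sums to at most [2/N]. *)
Let block_bounds M : x * E M <= B M <= E M + 2 / N%:R.
Proof.
have key i p : prime p -> (2 ^ i < p)%N -> (p <= 2 ^ i.+1)%N ->
   x * - ln (1 - f p) <= euler_log p * x ^+ i.+1
     <= - ln (1 - f p) + (1 - x ^+ i.+1) * inv_mul_pred p.
  move=> pp ip pi; have p1 := prime_gt1 pp; have p0 := prime_gt0 pp.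
  have /andP[L1 L2] := @ln_dyad_bounds R i p ip pi.
  pose t : R := p%:R `^ (- d).
  have tE : t = expR (- d * ln p%:R) by rewrite /t /powR pnatr_eq0 -[p == 0]negbK -lt0n p0.
  have xE k : x ^+ k = expR (- d * (k%:R * ln 2)).
    have -> : - d * (k%:R * ln 2) = k%:R * ln x by rewrite /d; field; rewrite gt_eqF.
    by rewrite expRM_natl lnK.
  have t_ge : x ^+ i.+1 <= t.
    by rewrite tE xE ler_expR ler_nM2l ?oppr_lt0.
  have t_le : t <= x ^+ i.
    by rewrite tE xE ler_expR ler_nM2l ?oppr_lt0.
  have t0 : 0 <= t by exact: powR_ge0.
  have t1 : t <= 1 by apply: (le_trans t_le); rewrite exprn_ile1// ltW.
  have fE : f p = t / p%:R by rewrite /f zeta_termE.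
  have /andP[h1 h2] := @euler_log_scale_bounds p t p1 (introT andP (conj t0 t1)).
  rewrite fE; have lpp : 0 <= euler_log p :> R := euler_log_ge0 p pp.
  have rpp : 0 <= inv_mul_pred p :> R := inv_mul_pred_ge0 p.
  apply/andP; split.
    rewrite exprS mulrCA ler_pM2l//; apply: (le_trans h1).
    by rewrite mulrC ler_wpM2l.
  apply: (@le_trans _ _ (t * euler_log p)); first by rewrite mulrC ler_wpM2r.
  apply: (le_trans h2); rewrite lerD2l ler_wpM2r// lerD2l lerN2//.
apply/andP; split.
  rewrite /E /B big_distrr/= ler_sum// => i _.
  rewrite -dyadZ [leRHS]mulrC -dyadZ; apply: ler_dyad => p pp ip pi.
  by have /andP[+ _] := key i p pp ip pi; rewrite [euler_log p * _]mulrC.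
apply: (@le_trans _ _ (E M + \sum_(0 <= i < M) (1 - x ^+ i.+1) * dyad inv_mul_pred i)).
  rewrite /E /B -big_split/= ler_sum// => i _.
  rewrite -dyadZ [leLHS]mulrC -dyadZ -dyadD; apply: ler_dyad => p pp ip pi.
  by have /andP[_ +] := key i p pp ip pi; rewrite [euler_log p * _]mulrC.
rewrite lerD2l mulrC.
apply: (@le_trans _ _ (\sum_(0 <= i < M) N%:R^-1 * (i.+1%:R * dyad inv_mul_pred i))).
  apply: ler_sum => i _; rewrite mulrA ler_wpM2r ?dyad_ge0// => [p _|].
    exact: inv_mul_pred_ge0.
  have Nx : N%:R^-1 = 1 - x by rewrite /x opprB addrC subrK.
  by rewrite mulrC Nx onem_expr_le// (ltW x0) ltW.
by rewrite -big_distrr/= ler_pM2l ?invr_gt0// sum_dyad_inv_mul_pred_le.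
Qed.

(** [E M] is [ln Z] minus the logarithm of [Z] times the sieve product over the primes up to
    [2 ^ M], and that last quantity tends to 1. *)
Let E_cvg : exists2 Z : R, E M @[M --> \oo] --> ln Z & d^-1 <= Z <= 1 + d^-1.
Proof.
have [Z cZ Zb] := zeta_cvg d d0; exists Z => //.
have Z0 : 0 < Z by have /andP[h _] := Zb; rewrite (lt_le_trans _ h)// invr_gt0.
have h := euler_product_cvg f Z (zeta_termM d) (zeta_term_ge0 d) (zeta_term0 d d0)
   (zeta_term1 d) cZ.
have f1 p : prime p -> f p < 1.
  move=> pp; have p1 := prime_gt1 pp.
  rewrite /f /powR pnatr_eq0 -[p == 0]negbK -lt0n (prime_gt0 pp)/= expR_lt1.
  by rewrite mulNr oppr_lt0 mulr_gt0// ?ln_gt0 ?ltr1n// addr_gt0.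
have EE M : E M = ln Z - ln (Z * \prod_(0 <= p < (2 ^ M).+1 | prime p) (1 - f p)).
  have p0 : 0 < \prod_(0 <= p < (2 ^ M).+1 | prime p) (1 - f p).
    by apply: prodr_gt0 => p pp; rewrite subr_gt0 f1.
  rewrite lnM ?posrE// opprD addrA subrr add0r ln_prod; last first.
    by move=> p pp; rewrite subr_gt0 f1.
  by rewrite sum_dyad /E -sumrN; apply: eq_bigr => i _; rewrite /dyad sumrN.
rewrite (_ : (fun M => E M) = (fun M => ln Z - ln (Z *
   \prod_(0 <= p < (2 ^ M).+1 | prime p) (1 - f p)))); last exact/funext.
rewrite -[X in _ --> X]subr0 -(@ln1 R); apply: cvgB; first exact: cvg_cst.
have h2 : Z * \prod_(0 <= p < (2 ^ M).+1 | prime p) (1 - f p) @[M --> \oo] --> (1 : R).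
  apply: (cvg_seq_comp _ _ (fun M => (2 ^ M).+1) _ h) => k.
  near=> M; rewrite (@leq_trans M)//; first by near: M; exact: nbhs_infty_ge.
  by rewrite ltnW// ltnW// ltnS ltn_expl.
apply: (cvg_comp _ (@ln R) h2); exact: continuous_ln ltr01.
Unshelve. all: by end_near.
Qed.

(** As [M] grows, the harmonic part of the truncated Abel sum tends to [- ln (1 - x) = ln N], while
    the prime part is caught between [x ln Z] and [ln Z + 2/N]. Since [Z] is [N ln 2] up to a
    bounded error, the difference is close to [ln (ln 2)]. *)
Lemma sum_harmonic_gap_bounds (e : R) :
  (forall M, (N <= M)%N -> `| \sum_(0 <= i < N) harmonic_gap i
     - \sum_(0 <= i < M) harmonic_gap i * x ^+ i.+1 | <= e) ->
  ln (x * ln 2) - ln (1 + N%:R * ln 2) / N%:R - e <= \sum_(0 <= i < N) harmonic_gap i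
    <= ln (ln 2 + N%:R^-1) + 2 / N%:R + e.
Proof.
move=> He; have [Z EZ /andP[Z1 Z2]] := E_cvg.
have /andP[d1 d2] := dV.
pose S M := \sum_(0 <= i < M) x ^+ i.+1 / i.+1%:R.
have SN : S M @[M --> \oo] --> ln N%:R.
  have := @ln_series_cvg R x; rewrite (ltW x0) x1 => /(_ isT).
  by rewrite {2}/x opprB addrC subrK lnV ?posrE// opprK.
have TE M : \sum_(0 <= i < M) harmonic_gap i * x ^+ i.+1 = B M - S M.
  rewrite /B /S -sumrB; apply: eq_bigr => i _.
  by rewrite /harmonic_gap mulrBl; congr (_ - _); rewrite mulrC.
have Z0 : 0 < Z by rewrite (lt_le_trans _ Z1)// invr_gt0.
have lnZ1 : ln ((N.-1)%:R * ln 2) <= ln Z.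
  rewrite ler_ln ?posrE//; first exact: le_trans Z1.
  by rewrite mulr_gt0.
have lnZ2 : ln Z <= ln (1 + N%:R * ln 2).
  rewrite ler_ln ?posrE//; last by rewrite addr_gt0// mulr_gt0.
  by apply: (le_trans Z2); rewrite lerD2l.
have lo : x * ln Z - ln N%:R - e <= \sum_(0 <= i < N) harmonic_gap i.
  have c : x * E M - S M - e @[M --> \oo] --> x * ln Z - ln N%:R - e.
    by apply: cvgB; [apply: cvgB; [apply: cvgMl_tmp|]|exact: cvg_cst].
  apply: (cvgr_to_le c); near=> M.
  have NM : (N <= M)%N by near: M; exact: nbhs_infty_ge.
  have := He M NM; rewrite TE; have /andP[b1 _] := block_bounds M.
  by rewrite ler_norml => /andP[h1 h2]; move: b1 h1 h2; lra.
have hi : \sum_(0 <= i < N) harmonic_gap i <= ln Z + 2 / N%:R - ln N%:R + e.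
  have c : E M + 2 / N%:R - S M + e @[M --> \oo] --> ln Z + 2 / N%:R - ln N%:R + e.
    apply: cvgD; last exact: cvg_cst.
    by apply: cvgB => //; apply: cvgD => //; exact: cvg_cst.
  apply: (cvgr_to_ge c); near=> M.
  have NM : (N <= M)%N by near: M; exact: nbhs_infty_ge.
  have := He M NM; rewrite TE; have /andP[_ b1] := block_bounds M.
  by rewrite ler_norml => /andP[h1 h2]; move: b1 h1 h2; lra.
have E1 : ln (x * ln 2) = ln ((N.-1)%:R * ln 2) - ln N%:R.
  rewrite -ln_div ?posrE//; last by rewrite mulr_gt0.
  congr ln; have pE := NE.
  by rewrite /x mulrAC; congr (_ * _); rewrite pE; field; rewrite -pE gt_eqF.
have E2 : ln (ln (2 : R) + (N%:R^-1 : R)) = ln (1 + N%:R * ln (2 : R)) - ln (N%:R : R).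
  rewrite -ln_div ?posrE//; last by rewrite addr_gt0// mulr_gt0.
  by congr ln; field; rewrite gt_eqF.
rewrite E1 E2; apply/andP; split; last by move: hi lnZ2; lra.
apply: le_trans lo; rewrite lerD2r.
have -> : x * ln Z = ln Z - ln Z / N%:R by rewrite /x mulrBl mul1r mulrC.
have : ln Z / N%:R <= ln (1 + N%:R * ln 2) / N%:R by rewrite ler_wpM2r ?invr_ge0// ltW.
by move: lnZ1; lra.
Unshelve. all: by end_near.
Qed.
End FixN.
End Mertens3.

(** * Limits: the gap series, Mertens' third theorem and the product of [1 + 1/p] *)

Section Limits.
Context {R : realType}.

Lemma cvg_invn : (n%:R^-1 : R) @[n --> \oo] --> (0 : R).
Proof. by rewrite -cvg_shiftS; exact: cvg_harmonic. Qed.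

Lemma cvg_ln (u : nat -> R) (l : R) : 0 < l -> u n @[n --> \oo] --> l ->
  ln (u n) @[n --> \oo] --> ln l.
Proof. by move=> l0 ul; apply: (cvg_comp _ (@ln R) ul); exact: continuous_ln. Qed.

Lemma cvg_ln_affine_div (a : R) : 0 <= a ->
  ln (1 + n%:R * a) / n%:R @[n --> \oo] --> (0 : R).
Proof.
move=> a0; apply/cvgrPdist_le => e e0; near=> n.
have n0 : (0 : R) < n%:R by rewrite ltr0n; near: n; exact: nbhs_infty_gt.
(* Applying [ln z <= z - 1] to [z = s (1 + n a)] gives a bound of slope [s a <= e/2] in [n]; its
   constant part [s - ln s] is absorbed by another [e/2 * n] for large [n]. *)
pose s := e / 2 / (1 + a).
have s0 : 0 < s by rewrite !divr_gt0// ltr_pwDl.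
have z1 : 1 <= 1 + n%:R * a by rewrite lerDl mulr_ge0// ltW.
have z0 : 0 < 1 + n%:R * a by apply: lt_le_trans z1.
rewrite sub0r normrN ger0_norm; last by rewrite divr_ge0 ?ln_ge0// ltW.
rewrite ler_pdivrMr//.
have := ln_leB1 _ (mulr_gt0 s0 z0); rewrite lnM ?posrE// => h.
have hn : (s - ln s) / (e / 2) <= n%:R by near: n; exact: nbhs_infty_ger.
have e2 : 0 < e / 2 by rewrite divr_gt0.
rewrite ler_pdivrMr// in hn.
have sE : s * (1 + a) = e / 2 by rewrite /s divfK// gt_eqF// ltr_pwDl.
have k : s * n%:R * a <= e / 2 * n%:R.
  by rewrite mulrAC ler_pM2r// -sE ler_pM2l// lerDr.
by move: h hn k; move: (ln (1 + n%:R * a)) (ln s) => u v; move: (n%:R : R) => w; lra.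
Unshelve. all: by end_near.
Qed.

Lemma sum_harmonic_gap_cvg :
  \sum_(0 <= i < N) harmonic_gap i @[N --> \oo] --> ln (ln (2 : R)).
Proof.
have l0 := @ln2_gt0 R.
have cL : ln ((1 - N%:R^-1) * ln 2) - ln (1 + N%:R * ln 2) / N%:R @[N --> \oo]
    --> ln (ln (2 : R)).
  rewrite -[X in _ --> X]subr0; apply: cvgB; last exact: cvg_ln_affine_div (ltW l0).
  apply: cvg_ln => //; rewrite -[X in _ --> X]mul1r; apply: cvgMr_tmp.
  by rewrite -[X in _ --> X]subr0; apply: cvgB; [exact: cvg_cst|exact: cvg_invn].
have cU : ln (ln 2 + N%:R^-1) + 2 / N%:R @[N --> \oo] --> ln (ln (2 : R)).
  rewrite -[X in _ --> X]addr0; apply: cvgD.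
    apply: cvg_ln => //; rewrite -[X in _ --> X]addr0.
    by apply: cvgD; [exact: cvg_cst|exact: cvg_invn].
  by rewrite -[X in _ --> X](mulr0 (2 : R)); apply: cvgMl_tmp; exact: cvg_invn.
apply/cvgrPdist_le => e e0; have e2 : 0 < e / 2 by rewrite divr_gt0.
have tb := @tauber R harmonic_gap (@sum_mul_harmonic_gap_little R) (e / 2) e2.
move/cvgrPdist_le : cL => /(_ _ e2) cL; move/cvgrPdist_le : cU => /(_ _ e2) cU.
near=> N.
have N1 : (1 < N)%N by near: N; exact: nbhs_infty_gt.
have := @sum_harmonic_gap_bounds R N N1 (e / 2).
have t1 : forall M, (N <= M)%N -> `| \sum_(0 <= i < N) harmonic_gap i
     - \sum_(0 <= i < M) harmonic_gap i * (1 - N%:R^-1) ^+ i.+1 | <= e / 2 by near: N.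
move=> /(_ t1) /andP[h1 h2].
have : `|ln (ln 2) - (ln ((1 - N%:R^-1) * ln 2) - ln (1 + N%:R * ln 2) / N%:R)| <= e / 2.
  by near: N.
have : `|ln (ln 2) - (ln (ln 2 + N%:R^-1) + 2 / N%:R)| <= e / 2 by near: N.
rewrite !ler_norml => /andP[h3 h4] /andP[h5 h6].
by apply/andP; split; lra.
Unshelve. all: by end_near.
Qed.

(** A definition by [limn] is informative only once convergence is known; here the sequence is
    nonincreasing and nonnegative from index 1 on. *)
Lemma euler_gamma_cvg :
  series harmonic n - ln n%:R @[n --> \oo] --> (euler_gamma : R).
Proof.
suff cv : cvgn (fun n : nat => series harmonic n - ln n%:R : R) by exact: cv.
pose u (n : nat) : R := series harmonic n - ln n%:R.
(* The shift discards index 0, where [ln 0 = 0] makes the term 0, below the next term 1. *)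
suff /cvg_ex[l] : cvgn (fun n => u n.+1) by rewrite cvg_shiftS => ul; apply/cvg_ex; exists l.
have hS n : series harmonic n.+1 = series harmonic n + n.+1%:R^-1 :> R.
  by rewrite /series/= big_nat_recr.
apply: nonincreasing_is_cvgn.
  apply/nonincreasing_seqP => n; have := hS n.+1; rewrite /u.
  have /andP[h _] := @ln_succ_bounds R n.+1 isT; move: h.
  move: (series _ n.+2) (series _ n.+1) => a b.
  by move: (n.+2%:R^-1 : R) (ln n.+2%:R) (ln n.+1%:R) => v x y h e; rewrite e; lra.
suff h n : ln (n.+1%:R : R) <= series harmonic n.
  exists 0 => _ [n _ <-]; rewrite /= subr_ge0; apply: (le_trans (h n)).
  by rewrite hS lerDl invr_ge0.
elim: n => [|n IH]; first by rewrite ln1 /series/= big_geq.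
have /andP[_ h] := @ln_succ_bounds R n.+1 isT.
rewrite hS; move: IH h; move: (n.+1%:R^-1 : R) => v; lra.
Qed.

Definition mertens_sum (y : nat) : R := \sum_(0 <= p < y.+1 | prime p) euler_log p.

Lemma mertens_sum_homo m n : (m <= n)%N -> mertens_sum m <= mertens_sum n.
Proof.
move=> mn; rewrite /mertens_sum [leRHS](@big_cat_nat _ _ _ m.+1)//= lerDl.
by rewrite sumr_ge0// => p pp; exact: euler_log_ge0.
Qed.

Lemma mertens_dyadic_cvg :
  mertens_sum (2 ^ N) - ln N%:R @[N --> \oo] --> ln (ln 2) + (euler_gamma : R).
Proof.
rewrite (_ : (fun N => _) = (fun N => \sum_(0 <= i < N) harmonic_gap i +
   (series harmonic N - ln N%:R))).
  by apply: cvgD; [exact: sum_harmonic_gap_cvg|exact: euler_gamma_cvg].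
apply/funext => N; rewrite /mertens_sum sum_dyad addrA; congr (_ - _).
rewrite /series/= -big_split/=; apply: eq_bigr => i _.
by rewrite /harmonic_gap subrK.
Qed.

(** For [2^N <= y < 2^(N+1)] the sum is monotone in [y] and [ln (ln y)] lies between
    [ln N + ln (ln 2)] and [ln (N+1) + ln (ln 2)]. The gap tends to 0, and [ln (ln 2)] cancels
    against the dyadic limit. *)
Lemma mertens_third :
  mertens_sum y - ln (ln y%:R) @[y --> \oo] --> (euler_gamma : R).
Proof.
have l0 := @ln2_gt0 R.
have cS : mertens_sum (2 ^ N.+1) - ln N.+1%:R @[N --> \oo] --> ln (ln 2) + (euler_gamma : R).
  have := mertens_dyadic_cvg; rewrite -cvg_shiftS; exact.
have cD : ln N.+1%:R - ln N%:R @[N --> \oo] --> (0 : R).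
  apply: (@squeeze_cvgr _ _ _ _ (cst 0) (fun N => N%:R^-1)).
  - near=> N; have N0 : (0 < N)%N by near: N; exact: nbhs_infty_gt.
    have /andP[h1 h2] := @ln_succ_bounds R N N0.
    by rewrite h2 andbT (le_trans _ h1)// invr_ge0.
  - exact: cvg_cst.
  - exact: cvg_invn.
have gE : euler_gamma = ln (ln 2) + euler_gamma - ln (ln (2 : R)) by rewrite addrAC subrr add0r.
have cU : mertens_sum (2 ^ N.+1) - ln N%:R - ln (ln 2) @[N --> \oo] --> (euler_gamma : R).
  rewrite gE; apply: cvgB; last exact: cvg_cst.
  rewrite (_ : (fun N => _) = (fun N => (mertens_sum (2 ^ N.+1) - ln N.+1%:R) +
     (ln N.+1%:R - ln N%:R))); last by apply/funext => N; rewrite addrA subrK.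
  by rewrite -[X in _ --> X]addr0; apply: cvgD.
have cL : mertens_sum (2 ^ N) - ln N.+1%:R - ln (ln 2) @[N --> \oo] --> (euler_gamma : R).
  rewrite gE; apply: cvgB; last exact: cvg_cst.
  rewrite (_ : (fun N => _) = (fun N => (mertens_sum (2 ^ N) - ln N%:R) -
     (ln N.+1%:R - ln N%:R))); last by apply/funext => N; rewrite opprB addrA subrK.
  by rewrite -[X in _ --> X]subr0; apply: cvgB => //; exact: mertens_dyadic_cvg.
have tl K : \forall y \near \oo, (K <= trunc_log 2 y)%N.
  near=> y; rewrite trunc_log_max//.
  by near: y; exact: nbhs_infty_ge.
apply: (@squeeze_cvgr _ _ _ _
  (fun y => (fun N => mertens_sum (2 ^ N) - ln N.+1%:R - ln (ln 2)) (trunc_log 2 y))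
  (fun y => (fun N => mertens_sum (2 ^ N.+1) - ln N%:R - ln (ln 2)) (trunc_log 2 y))).
- near=> y; have y2 : (2 <= y)%N by near: y; exact: nbhs_infty_ge.
  have N0 : (1 <= trunc_log 2 y)%N by near: y.
  have yL : (2 ^ trunc_log 2 y <= y)%N by rewrite trunc_logP//; lia.
  have yU : (y < 2 ^ (trunc_log 2 y).+1)%N by rewrite trunc_log_ltn.
  move: (trunc_log 2 y) N0 yL yU => N N0 yL yU.
  have N0' : (0 : R) < N%:R by rewrite ltr0n.
  have lL : N%:R * ln 2 <= ln (y%:R : R).
    by rewrite mulr_natl -lnXn// -natrX ler_ln_nat ?expn_gt0.
  have lU : ln (y%:R : R) <= N.+1%:R * ln 2.
    by rewrite mulr_natl -lnXn// -natrX ler_ln_nat//; lia.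
  have ly0 : 0 < ln (y%:R : R) by apply: lt_le_trans lL; rewrite mulr_gt0.
  have llL : ln N%:R + ln (ln 2) <= ln (ln (y%:R : R)).
    by rewrite -lnM ?posrE// ler_ln ?posrE// mulr_gt0.
  have llU : ln (ln (y%:R : R)) <= ln N.+1%:R + ln (ln 2).
    by rewrite -lnM ?posrE ?ltr0n// ler_ln ?posrE// mulr_gt0.
  have mL := mertens_sum_homo _ _ yL; have mU := mertens_sum_homo _ _ (ltnW yU).
  by apply/andP; split; lra.
- exact: (cvg_seq_comp _ _ _ tl cL).
- exact: (cvg_seq_comp _ _ _ tl cU).
Unshelve. all: by end_near.
Qed.

(** The ratio [psi(n)/n] of Dedekind's psi function at the product [n] of the primes up to [y]. *)
Definition psi_prod (y : nat) : R := \prod_(0 <= p < y.+1 | prime p) (1 + p%:R^-1).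

(** Factor by factor [1 + v = (1 - v^2) / (1 - v)] with [v = 1/p]: the numerators give [1/zeta(2)],
    the denominators Mertens' third theorem. *)
Lemma psi_prod_cvg :
  psi_prod y / ln y%:R @[y --> \oo] --> 6 / pi ^+ 2 * expR (euler_gamma : R).
Proof.
have c1 : \prod_(0 <= p < y.+1 | prime p) (1 - ((p%:R : R)^-1) ^+ 2) @[y --> \oo]
    --> 6 / pi ^+ 2.
  by have := @prod_1BinvSqr_cvg R; rewrite -cvg_shiftS; exact.
have c2 : expR (mertens_sum y - ln (ln y%:R)) @[y --> \oo] --> expR (euler_gamma : R).
  by apply: (cvg_comp _ (@expR R) mertens_third); exact: continuous_expR.
apply: cvg_trans (cvgM c1 c2); apply: near_eq_cvg; near=> y.
have y2 : (1 < y)%N by near: y; exact: nbhs_infty_gt.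
have ly0 : 0 < ln (y%:R : R) by rewrite ln_gt0// ltr1n.
rewrite /= expRB lnK ?posrE// mulrA; congr (_ / _).
rewrite /mertens_sum expR_sum -big_split/=; apply: eq_bigr => p pp.
have p1 := prime_gt1 pp.
have v1 : (p%:R^-1 : R) < 1 by rewrite invf_lt1 ?ltr1n// ltr0n; lia.
have q0 : 0 < 1 - (p%:R^-1 : R) by rewrite subr_gt0.
rewrite /euler_log expRN lnK ?posrE//; move: (p%:R^-1 : R) q0 => v q0.
by field; rewrite gt_eqF.
Unshelve. all: by end_near.
Qed.
End Limits.

(** * The exponential Pillai function *)

(** The term [c = a] gives [p^a], the term [c = a - 1] gives [p] by coprimality, and the others at
    most [p^c] with [c <= a - 2]; all but the first add up to at most [p^(a-1)], by doubling. *)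
Lemma sum_expn_gcd_le p a : (1 < p)%N -> (1 < a)%N ->
  (\sum_(1 <= c < a.+1) p ^ gcdn c a <= p ^ a + p ^ a.-1)%N.
Proof.
case: a => [//|[//|a]] p1 _; rewrite big_nat_recr//= gcdnn addnC leq_add2l.
rewrite big_nat_recr//= (eqP (coprimenS a.+1)) expn1.
apply: (@leq_trans (\sum_(1 <= c < a.+1) p ^ c + p)).
  rewrite leq_add2r big_nat [leqRHS]big_nat; apply: leq_sum => c /andP[c1 _].
  by rewrite leq_exp2l// dvdn_leq// dvdn_gcdl.
elim: a => [|a IH]; first by rewrite big_geq// expn1.
rewrite big_nat_recr//= addnAC (@leq_trans (p ^ a.+1 + p ^ a.+1))%N ?leq_add2r//.
by rewrite addnn -mul2n [(p ^ a.+2)%N]expnS leq_mul2r p1 orbT.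
Qed.

(** * Upper bound for the ratio *)

Section Upper.
Context {R : realType}.

Lemma Ptilde_div_le n : (0 < n)%N ->
  (Ptilde n)%:R / n%:R <= \prod_(p <- primes n) (1 + p%:R^-1) :> R.
Proof.
move=> n0; rewrite [X in _ / X%:R](prod_prime_decomp n0) prime_decompE big_map/=.
rewrite /Ptilde !natr_prod -prodf_div.
rewrite big_seq [leRHS]big_seq ler_prod// => p.
rewrite mem_primes => /and3P[pp _ pn].
have p1 := prime_gt1 pp; have p0 := prime_gt0 pp.
rewrite divr_ge0//=; have : (0 < logn p n)%N by rewrite logn_gt0 mem_primes pp n0.
case: (logn p n) => [//|[|a]] _.
  by rewrite big_nat1 gcdnn divff ?lerDl ?invr_ge0// pnatr_eq0 expn1; lia.
have e0 : (0 : R) < (p ^ a.+2)%:R by rewrite ltr0n expn_gt0 p0.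
have p0' : (p%:R : R) != 0 by rewrite pnatr_eq0 -lt0n.
rewrite ler_pdivrMr//.
have -> : (1 + p%:R^-1) * (p ^ a.+2)%:R = (p ^ a.+2)%:R + (p ^ a.+1)%:R :> R.
  by rewrite mulrDl mul1r; congr (_ + _); rewrite expnS natrM mulKf.
by rewrite -natrD ler_nat; exact: sum_expn_gcd_le.
Qed.

(** The primes up to [y] contribute at most [psi_prod y]. For those above,
    [1/p <= ln p / ((y+1) ln (y+1))], and the [ln p] over primes dividing [n] sum to at most
    [ln n <= y + 1], so the sum of [1/p] is at most [1 / ln (y+1)]. *)
Lemma prod_primes_le n y : (0 < n)%N -> (0 < y)%N -> ln (n%:R : R) <= y.+1%:R ->
  \prod_(p <- primes n) (1 + p%:R^-1) <= psi_prod y * expR ((ln y.+1%:R)^-1) :> R.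
Proof.
move=> n0 y0 ny; pose X := (n + y).+1.
pose F p : R := 1 + p%:R^-1.
have F1 p : 1 <= F p by rewrite lerDl invr_ge0.
have F0 p : 0 <= F p by rewrite (le_trans _ (F1 p)).
have -> : \prod_(p <- primes n) F p = \prod_(0 <= p < X | p \in primes n) F p.
  rewrite -[RHS]big_filter; apply: perm_big; apply: uniq_perm.
  - exact: primes_uniq.
  - by rewrite filter_uniq// iota_uniq.
  - move=> p; rewrite mem_filter mem_index_iota /=.
    case pn : (p \in primes n) => //=; move: pn; rewrite mem_primes => /and3P[_ _ pn].
    by have := dvdn_leq n0 pn; rewrite /X; lia.
rewrite (@big_cat_nat _ _ _ y.+1)//=; last by rewrite /X; lia.
have l0 : 0 < ln (y.+1%:R : R) by rewrite ln_gt0// ltr1n.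
have Y0 : (0 : R) < y.+1%:R by rewrite ltr0n.
rewrite ler_pM ?prodr_ge0//.
  rewrite /psi_prod big_mkcond [leRHS]big_mkcond ler_prod// => p _.
  rewrite mem_primes n0/=; case: (prime p) => /=; last by rewrite ler01/=.
  by case: ifP => _; rewrite ?ler01 ?F0 ?F1 ?lexx.
apply: (@le_trans _ _ (expR (\sum_(y.+1 <= p < X | p \in primes n) p%:R^-1))).
  by rewrite expR_sum ler_prod// => p _; rewrite F0 expR_ge1Dx.
rewrite ler_expR.
apply: (@le_trans _ _ (\sum_(y.+1 <= p < X | p \in primes n)
    (logn p n)%:R * ln p%:R * (y.+1%:R * ln y.+1%:R)^-1)).
  rewrite big_nat_cond [leRHS]big_nat_cond ler_sum// => p /andP[/andP[yp _] pn].
  have lp1 : (1 : R) <= (logn p n)%:R by rewrite ler1n logn_gt0.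
  have lpy : ln y.+1%:R <= ln (p%:R : R) by rewrite ler_ln_nat.
  rewrite invfM [y.+1%:R^-1 * _]mulrC mulrA.
  apply: (@le_trans _ _ (y.+1%:R^-1)).
    by rewrite lef_pV2 ?posrE ?ltr0n ?ler_nat//; lia.
  rewrite ler_peMl ?invr_ge0// ler_pdivlMr// mul1r.
  by apply: (le_trans lpy); rewrite ler_peMl// (le_trans (ltW l0)).
rewrite -mulr_suml ler_pdivrMr ?mulr_gt0// mulrCA mulVf ?gt_eqF// mulr1.
apply: le_trans ny.
rewrite [leRHS](@ln_logn R n X n0); last first.
  by move=> p pp pn; have := dvdn_leq n0 pn; rewrite /X; lia.
rewrite [leRHS](@big_cat_nat _ _ _ y.+1)//=; last by rewrite /X; lia.
rewrite -[leLHS]add0r lerD//.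
  by rewrite sumr_ge0// => p pp; rewrite mulr_ge0// ln_prime_ge0.
rewrite big_mkcond [leRHS]big_mkcond/= ler_sum// => p _.
rewrite mem_primes n0/=; case pp : (prime p) => //=.
by case: ifP => // _; rewrite mulr_ge0// ln_prime_ge0.
Qed.

Definition limsup_const : R := 6 / pi ^+ 2 * expR euler_gamma.

Let u (n : nat) : R := (Ptilde n)%:R / (n%:R * ln (ln n%:R)).

Lemma inv_ln_cvg : (ln y.+1%:R)^-1 @[y --> \oo] --> (0 : R).
Proof.
apply/cvgrPdist_le => e e0; near=> y.
have h : e^-1 <= ln (y%:R : R) by near: y; exact: ln_nat_ge.
have y0 : (0 < y)%N by near: y; exact: nbhs_infty_gt.
have h2 : e^-1 <= ln (y.+1%:R : R) by apply: (le_trans h); exact: ler_ln_nat.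
have e0' : 0 < e^-1 by rewrite invr_gt0.
rewrite sub0r normrN ger0_norm ?invr_ge0 ?(le_trans (ltW e0') h2)//.
by rewrite -[leRHS]invrK lef_pV2 ?posrE// (lt_le_trans e0').
Unshelve. all: by end_near.
Qed.

(** The primes are cut at [y = floor (ln n)]: then [ln n < y + 1], as [prod_primes_le] requires, and
    [ln y <= ln (ln n)] lets the limit of [psi_prod y / ln y] bound the ratio. *)
Lemma Ptilde_ratio_upper e : 0 < e -> \forall n \near \oo, u n <= limsup_const + e.
Proof.
move=> e0.
have cU : psi_prod y / ln y%:R * expR ((ln y.+1%:R)^-1) @[y --> \oo] --> limsup_const.
  have -> : limsup_const = limsup_const * expR 0 by rewrite expR0 mulr1.
  apply: cvgM; first exact: psi_prod_cvg.
  by apply: (cvg_comp _ (@expR R) inv_ln_cvg); exact: continuous_expR.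
have tl K : \forall n \near \oo, (K <= Num.truncn (ln (n%:R : R)))%N.
  near=> n; have h : K%:R <= ln (n%:R : R) by near: n; exact: ln_nat_ge.
  by rewrite truncn_ge_nat// (le_trans _ h).
have c2 := cvg_seq_comp _ _ _ tl cU.
have Ce : limsup_const < limsup_const + e by rewrite ltrDl.
have := c2; move/cvgr_le => /(_ _ Ce); apply: filterS2 (tl 3) => n y3; apply: le_trans.
set y := Num.truncn _ in y3 *.
(* Having [y >= 3] excludes [n = 0], where [ln] takes its default value 0. *)
have n0 : (0 < n)%N by rewrite lt0n; apply/eqP => nE; move: y3; rewrite /y nE ln0// truncn0.
have l0 : 0 <= ln (n%:R : R) by rewrite ln_ge0// ler1n.
have /andP[yl yu] := truncn_itv l0; rewrite -/y in yl yu.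
have Y1 : (1 : R) < y%:R by rewrite ltr1n; lia.
have Y0 : (0 : R) < y%:R by rewrite ltr0n; lia.
have h1 := Ptilde_div_le n n0.
have h2 := prod_primes_le n y n0 (ltnW (ltnW y3)) (ltW yu).
have ly : 0 < ln (y%:R : R) by rewrite ln_gt0.
have lly : ln (y%:R : R) <= ln (ln n%:R) by rewrite ler_ln ?posrE ?(lt_le_trans Y0).
rewrite /u invfM mulrA ler_pdivrMr ?(lt_le_trans ly)//.
apply: (le_trans h1); apply: (le_trans h2).
move: (expR (ln y.+1%:R)^-1) (expR_ge0 ((ln (y.+1%:R : R))^-1)) => E E0.
have -> : psi_prod y / ln y%:R * E * ln (ln n%:R) =
    psi_prod y * E * (ln (ln (n%:R : R)) / ln y%:R) by field; rewrite gt_eqF.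
rewrite ler_peMr ?ler_pdivlMr ?mul1r// mulr_ge0 ?prodr_ge0//.
Unshelve. all: by end_near.
Qed.
End Upper.

(** * Lower bound along the squares of primorials *)

Definition primorial_sqr (y : nat) : nat := (\prod_(0 <= p < y | prime p) p ^ 2)%N.

Lemma primorial_sqr_gt0 y : (0 < primorial_sqr y)%N.
Proof. by rewrite prodn_cond_gt0// => p pp; rewrite expn_gt0 prime_gt0. Qed.

Lemma primorial_sqrS y : primorial_sqr y.+1 = (primorial_sqr y * (if prime y then y ^ 2 else 1))%N.
Proof. by rewrite /primorial_sqr big_mkcond/= big_nat_recr//= -big_mkcond. Qed.

Lemma coprime_primorial_sqr y : prime y -> coprime (primorial_sqr y) y.
Proof.
move=> yp; rewrite coprime_sym /primorial_sqr big_nat_cond.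
elim/big_ind : _ => [|m n h1 h2|p /andP[/andP[_ py] pp]]; first exact: coprimen1.
  by rewrite coprimeMr h1.
rewrite coprimeXr// prime_coprime// dvdn_prime2//; apply/eqP => e.
by rewrite e ltnn in py.
Qed.

(** At exponent 2 the gcds are 1 and 2, so the local factor is [p + p^2 = p^2 (1 + 1/p)], the
    extremal case of [sum_expn_gcd_le]. *)
Lemma Ptilde_primorial_sqr y :
  Ptilde (primorial_sqr y) = (\prod_(0 <= p < y | prime p) (p + p ^ 2))%N.
Proof.
elim: y => [|y IH]; first by rewrite /primorial_sqr !big_geq// Ptilde1.
rewrite primorial_sqrS [RHS]big_mkcond big_nat_recr//= -big_mkcond -IH.
case: ifP => yp; last by rewrite !muln1.
rewrite PtildeM ?primorial_sqr_gt0 ?expn_gt0 ?prime_gt0// ?coprimeXr ?coprime_primorial_sqr//.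
by rewrite Ptilde_prime_pow// big_ltn// big_nat1.
Qed.

Lemma leq_primorial_sqr p y : prime p -> (p < y)%N -> (p <= primorial_sqr y)%N.
Proof.
move=> pp py; apply: dvdn_leq; first exact: primorial_sqr_gt0.
rewrite /primorial_sqr big_mkcond (bigD1_seq p) ?iota_uniq ?mem_index_iota//= pp.
by rewrite dvdn_mulr// dvdn_mulr.
Qed.

Section Lower.
Context {R : realType}.
Let u (n : nat) : R := (Ptilde n)%:R / (n%:R * ln (ln n%:R)).

Lemma Ptilde_primorial_sqr_div y :
  (Ptilde (primorial_sqr y.+1))%:R / (primorial_sqr y.+1)%:R = psi_prod y :> R.
Proof.
rewrite Ptilde_primorial_sqr /primorial_sqr !natr_prod -prodf_div; apply: eq_bigr => p pp.
rewrite natrD natrX; field; rewrite pnatr_eq0; have := prime_gt0 pp; lia.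
Qed.

Lemma ln_primorial_sqr_le N : ln ((primorial_sqr (2 ^ N).+1)%:R : R) <= 2 ^+ N * (4 * ln 2).
Proof.
rewrite /primorial_sqr natr_prod ln_prod; last first.
  by move=> p pp; rewrite ltr0n expn_gt0 prime_gt0.
rewrite (eq_bigr (fun p : nat => 2 * ln (p%:R : R))) => [|p pp]; last first.
  by rewrite natrX lnXn ?ltr0n ?prime_gt0// mulr_natl.
rewrite -big_distrr/= sum_dyad; have := @sum_dyad_ln_le R N; lra.
Qed.

(* Along y = 2^N Chebyshev's bound on ln n is the sum of its dyadic blocks. *)
Lemma Ptilde_ratio_lower (e : R) (T : nat) : 0 < e ->
  exists2 n : nat, (T <= n)%N & limsup_const - e <= u n.
Proof.
move=> e0; have l0 := @ln2_gt0 R.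
have cN : psi_prod (2 ^ N) / ln (2 ^ N)%:R @[N --> \oo] --> (limsup_const : R).
  apply: (cvg_seq_comp (fun y => psi_prod y / ln y%:R) limsup_const
    (fun N => 2 ^ N)%N _ psi_prod_cvg).
  move=> K; near=> N; rewrite (@leq_trans N)//; first by near: N; exact: nbhs_infty_ge.
  by rewrite ltnW// ltn_expl.
(* Chosen so that [N ln 2 * (1 + c/N) = N ln 2 + |ln (4 ln 2)|], an upper bound for [ln (ln n)]; the
   absolute value keeps [c] nonnegative without evaluating the logarithm. *)
pose c : R := `|ln (4 * ln 2)| / ln 2.
have c0 : 0 <= c by rewrite divr_ge0// ltW.
have cW : psi_prod (2 ^ N) / ln (2 ^ N)%:R * (1 + c * N%:R^-1)^-1 @[N --> \oo]
    --> (limsup_const : R).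
  rewrite -[X in _ --> X]mulr1; apply: cvgM => //.
  rewrite -[X in _ --> X]invr1; apply: cvgV => //.
  rewrite -[X in _ --> X]addr0; apply: cvgD; first exact: cvg_cst.
  by rewrite -[X in _ --> X](mulr0 c); apply: cvgMl_tmp; exact: cvg_invn.
have Ce : limsup_const - e < limsup_const by rewrite gtrBl.
move/cvgr_ge : cW => /(_ _ Ce) h.
(* A prime factor [q] of [n] beyond both [T] and [e = expR 1] forces [n >= T] and [ln n > 1], so
   that [ln (ln n)] is positive. *)
have [q Tq qp] := prime_above (T + (Num.truncn (expR 1 : R)).+1)%N.
near \oo => N.
have N0 : (0 < N)%N by near: N; exact: nbhs_infty_gt.
have qN : (q <= N)%N by near: N; exact: nbhs_infty_ge.
have h1 : limsup_const - e <= psi_prod (2 ^ N) / ln (2 ^ N)%:R * (1 + c * N%:R^-1)^-1 by near: N.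
pose n := primorial_sqr (2 ^ N).+1.
have n0 : (0 : R) < n%:R by rewrite ltr0n primorial_sqr_gt0.
exists n.
  rewrite (@leq_trans q)//; first by lia.
  rewrite leq_primorial_sqr// ltnS (leq_trans qN)//.
  by rewrite ltnW// ltn_expl.
apply: (le_trans h1); rewrite /u invfM mulrA Ptilde_primorial_sqr_div -mulrA -invfM.
have n3 : 1 < ln (n%:R : R).
  suff : ln (expR 1) < ln (n%:R : R) by rewrite expRK.
  rewrite ltr_ln ?posrE ?expR_gt0//.
  apply: (lt_le_trans (truncnS_gt _)); rewrite ler_nat.
  rewrite (leq_trans (leq_addl T _))// (leq_trans (ltnW Tq))//.
  by rewrite leq_primorial_sqr// ltnS (leq_trans qN)// ltnW// ltn_expl.
have ll0 : 0 < ln (ln (n%:R : R)) by rewrite ln_gt0.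
have NR : (0 : R) < N%:R by rewrite ltr0n.
rewrite ler_wpM2l ?prodr_ge0//.
have lE : ln ((2 ^ N)%:R : R) = N%:R * ln 2 by rewrite natrX lnXn// mulr_natl.
rewrite lE; have -> : N%:R * ln 2 * (1 + c * N%:R^-1) = N%:R * ln 2 + `|ln (4 * ln 2)|.
  by rewrite /c; field; rewrite !gt_eqF.
have D0 : 0 < N%:R * ln 2 + `|ln (4 * ln (2 : R))| by rewrite ltr_pwDl// mulr_gt0.
rewrite lef_pV2 ?posrE//.
have : ln (ln (n%:R : R)) <= ln (2 ^+ N * (4 * ln 2)).
  rewrite ler_ln ?posrE ?(lt_trans _ n3)// ?mulr_gt0 ?exprn_gt0//.
  exact: ln_primorial_sqr_le.
rewrite lnM ?posrE ?exprn_gt0 ?mulr_gt0// lnXn// -[ln _ *+ N]mulr_natl => /le_trans; apply.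
by rewrite lerD2l ler_norm.
Unshelve. all: by end_near.
Qed.
End Lower.

Theorem theorem4 (R : realType) :
  limn_esup (fun n : nat =>
    ((Ptilde n)%:R / (n%:R * ln (ln n%:R)) : R)%:E)
  = (6 / pi ^+ 2 * expR euler_gamma)%:E.
Proof.
(* Unfolded, the limsup is an infimum, over neighbourhoods of infinity, of suprema. For the upper
   half one tail suffices; for the lower half every neighbourhood contains some tail, in which an
   index with a large ratio is found. *)
rewrite -/limsup_const /limn_esup /limf_esup; apply/eqP; rewrite eq_le; apply/andP; split.
  apply/lee_addgt0Pr => e e0; rewrite -EFinD.
  have [n0 _ Hn] := @Ptilde_ratio_upper R e e0.
  apply: (@le_trans _ _ (ereal_sup [set ((Ptilde n)%:R / (n%:R * ln (ln n%:R)) : R)%:E |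
     n in [set n | (n0 <= n)%N]])).
    apply: ereal_inf_lbound; exists [set n | (n0 <= n)%N] => //.
    by exists n0.
  by apply: ge_ereal_sup => _ [n /= nn <-]; rewrite lee_fin; exact: Hn.
apply: le_ereal_inf_tmp => _ [V [n0 _ n0V] <-].
apply/lee_subgt0Pr => e e0; rewrite -EFinB.
have [n nn Cn] := @Ptilde_ratio_lower R e n0 e0.
apply: (@le_trans _ _ ((Ptilde n)%:R / (n%:R * ln (ln n%:R)) : R)%:E).
  by rewrite lee_fin.
by apply: ereal_sup_ubound; exists n => //; exact: n0V.
Qed.
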